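(* Let $\theta^0=\mathrm{vec}\{a_k^0,w_k^0\}_{k=1}^m$ be the random initialization with independent $a_k^0\sim\mathcal N(0,\gamma^2)$ and $w_k^0\sim\mathcal N(0,I_d)$, $k=1,\dots,m$, for any $\gamma\in(0,1)$, and let $\theta(t)$, $t\ge 0$, be the gradient descent (gradient flow) trajectory $\dot\theta=-\nabla_\theta R_S(\theta)$, $\theta(0)=\theta^0$. Let $C_d:=\mathbb E\|w\|_1^{12}<+\infty$ with $w\sim\mathcal N(0,I_d)$, and let $\lambda_S:=\lambda_{\min}(K^{(a)})>0$. For any $\delta\in(0,1)$, with probability at least $1-\delta$ over the random initialization $\theta^0$ the following implication holds: if $$m\ge\max\left\{\frac{512\,n^4M^4C_d}{\lambda_S^2\delta},\ \frac{200\sqrt2\,Md^3n\log(4m(d+1)/\delta)\sqrt{R_S(\theta^0)}}{\lambda_S},\ \frac{2^{23}M^3d^9n^2\left(\log(4m(d+1)/\delta)\right)^4\sqrt{R_S(\theta^0)}}{\lambda_S^2}\right\},$$ then for all $t\ge0$, $$R_S(\theta(t))\le\exp\left(-\frac{m\lambda_S t}{n}\right)R_S(\theta^0).$$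
   Context: Let $\Omega=[0,1]^d$. The differential operator is $\mathcal L u=\sum_{\alpha,\beta=1}^d A_{\alpha\beta}(x)u_{x_\alpha x_\beta}+\sum_{\alpha=1}^d b_\alpha(x)u_{x_\alpha}+c(x)u$, where there is a constant $M\ge1$ such that for all $x\in\Omega$, $\alpha,\beta\in\{1,\dots,d\}$: $A_{\alpha\beta}=A_{\beta\alpha}$, $|A_{\alpha\beta}(x)|\le M$, $|b_\alpha(x)|\le M$, $|c(x)|\le M$. Write $A=(A_{\alpha\beta})$, $b=(b_\alpha)$. The right-hand side $f:\Omega\to\mathbb R$ satisfies $|f|\le1$. The activation is $\sigma(z)=\max\{\tfrac16z^3,0\}$, so $\sigma'(z)=\max\{\tfrac12 z^2,0\}$ for $z\geq 0$ and $\sigma'(z)=0$ for $z<0$, and $\sigma''(z)=\max\{z,0\}$; $\sigma^{(3)}$ is the derivative of $\max\{z,0\}$. The two-layer network of width $m$ is $\phi(x;\theta)=\sum_{k=1}^m a_k\sigma(w_k^{\top}x)$ with $a_k\in\mathbb R$, $w_k\in\mathbb R^d$, $\theta=\mathrm{vec}\{a_k,w_k\}_{k=1}^m$, and $$f_\theta(x):=\mathcal L\phi(x;\theta)=\sum_{k=1}^m a_k\left[w_k^{\top}A(x)w_k\,\sigma''(w_k^{\top}x)+b(x)^{\top}w_k\,\sigma'(w_k^{\top}x)+c(x)\sigma(w_k^{\top}x)\right].$$ Given samples $S=\{x_i\}_{i=1}^n\subset\Omega$ (i.i.d. uniform on $\Omega$, fixed during training), the empirical risk is $R_S(\theta)=\frac1{2n}\sum_{i=1}^n(f_\theta(x_i)-f(x_i))^2$.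 Define $g^{(a)}(w;x,x'):=\left[w^{\top}A(x)w\,\sigma''(w^{\top}x)+b(x)^{\top}w\,\sigma'(w^{\top}x)+c(x)\sigma(w^{\top}x)\right]\cdot\left[w^{\top}A(x')w\,\sigma''(w^{\top}x')+b(x')^{\top}w\,\sigma'(w^{\top}x')+c(x')\sigma(w^{\top}x')\right]$, $k^{(a)}(x,x'):=\mathbb E_{w\sim\mathcal N(0,I_d)}g^{(a)}(w;x,x')$, and the $n\times n$ Gram matrix $K^{(a)}$ with entries $K^{(a)}_{ij}=k^{(a)}(x_i,x_j)$. It is assumed that $\lambda_S:=\lambda_{\min}(K^{(a)})>0$. *)

(* Defs.v *)
From HB Require Import structures.
From mathcomp Require Import all_boot all_order all_algebra.
From mathcomp Require Import all_classical all_reals all_analysis.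
From mathcomp Require Import ring lra.

Set Implicit Arguments.
Unset Strict Implicit.
Unset Printing Implicit Defensive.

Import Order.TTheory GRing.Theory Num.Theory.
Import numFieldNormedType.Exports.

Local Open Scope classical_set_scope.
Local Open Scope ring_scope.

Section linear_algebra.
Context {R : realType}.

Definition dot d (u v : 'cV[R]_d) : R := (u^T *m v) 0 0.

Definition vec d (w : d.-tuple R) : 'cV[R]_d := \col_j tnth w j.

Definition norm1 d (u : 'cV[R]_d) : R := \sum_j `|u j 0|.

(* The set of eigenvalues of a real symmetric matrix is finite, and nonempty
   when n > 0, so that the infimum is the least eigenvalue. *)
Definition lambda_min n (K : 'M[R]_n) : R := inf [set a | eigenvalue K a].

Definition cube d : set 'cV[R]_d := [set x | forall j, 0 <= x j 0 <= 1].

End linear_algebra.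

Section activation.
Context {R : realType}.

Definition sigma (z : R) : R := Num.max (z ^+ 3 / 6) 0.
Definition sigma1 (z : R) : R := if 0 <= z then z ^+ 2 / 2 else 0.
Definition sigma2 (z : R) : R := Num.max z 0.

Lemma is_derive_quadratic (f : R -> R) (z l C : R) :
  (forall h, `|h| <= 1 -> `|f (h + z) - f z - h * l| <= C * h ^+ 2) ->
  is_derive z 1 f l.
Proof.
move=> fC.
have C0 : 0 <= C.
  have := fC 1; rewrite normr1 expr1n mulr1 => /(_ (lexx _)).
  exact: le_trans (normr_ge0 _).
have H : (fun h : R => h^-1 *: ((f \o shift z) (h *: 1) - f z)) @ 0^' --> l.
  apply/cvgrPdist_le => /= e e0; near=> h.
  have h0 : h != 0 by near: h; exact: nbhs_dnbhs_neq.
  have h1 : `|h| <= 1.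
    near: h; apply: dnbhs0_le => //.
  have he : `|h| <= e / (C + 1).
    near: h; apply: dnbhs0_le; rewrite divr_gt0//; lra.
  rewrite /= distrC [h *: 1]mulr1.
  rewrite (_ : _ - l = h^-1 * (f (h + z) - f z - h * l)); last first.
    by rewrite /GRing.scale/=; field.
  rewrite normrM normfV ler_pdivrMl ?normr_gt0//.
  apply: le_trans (fC _ h1) _.
  rewrite -[h ^+ 2]ger0_norm ?sqr_ge0// normrX expr2 mulrCA ler_wpM2l//.
  apply: le_trans (ler_wpM2l C0 he) _.
  rewrite mulrCA ler_piMr ?(ltW e0)// ler_pdivrMr; lra.
split; first by apply/cvg_ex; exists l.
by rewrite /derive; apply: cvg_lim.
Unshelve. all: by end_near. Qed.


Lemma sigmaE z : sigma z = if 0 <= z then z ^+ 3 / 6 else 0.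
Proof.
rewrite /sigma; case: ifPn => [z0|].
  by rewrite max_l// divr_ge0 ?exprn_ge0.
rewrite -ltNge => z0; rewrite max_r// nmulr_rle0; first by rewrite invr_ge0.
by rewrite exprn_odd_lt0.
Qed.

Lemma sigma2E z : sigma2 z = if 0 <= z then z else 0.
Proof.
by rewrite /sigma2; case: ifPn => [/max_l//|]; rewrite -ltNge => /ltW/max_r.
Qed.

Lemma is_derive_sigma (z : R) : is_derive z 1 sigma (sigma1 z).
Proof.
apply: (@is_derive_quadratic _ _ _ (`|z| + 1)) => h; rewrite ler_norml => h1.
rewrite !sigmaE /sigma1.
have zz := ler_norm z; have zNz := ler_norm (- z); rewrite normrN in zNz.
move: (`|z|) zz zNz => y zz zNz; rewrite ler_norml.
case: (leP 0 z) => z0; case: (leP 0 (h + z)) => hz.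
- rewrite (_ : _ - _ - _ = (z * h ^+ 2 / 2 + h ^+ 3 / 6)); first nra.
  by field.
- have := sqr_ge0 z; have := sqr_ge0 h; nra.
- nra.
- nra.
Qed.

Lemma is_derive_sigma1 (z : R) : is_derive z 1 sigma1 (sigma2 z).
Proof.
apply: (@is_derive_quadratic _ _ _ 1) => h _.
rewrite !sigma2E /sigma1 ler_norml.
case: (leP 0 z) => z0; case: (leP 0 (h + z)) => hz; nra.
Qed.

Lemma is_derive_dot d (s : R -> R) (l : R) (w x : 'cV[R]_d) (j : 'I_d) :
  is_derive (dot w x) 1 s l ->
  is_derive x (delta_mx j 0) (fun y => s (dot w y)) (w j 0 * l).
Proof.
move=> [ds sl].
have dotD h : dot w (h *: delta_mx j 0 + x) = h *: w j 0 + dot w x.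
  rewrite /dot mulmxDr -scalemxAr mxE [X in X + _]mxE; congr (_ * _ + _).
  by rewrite -colE !mxE.
have /derivable1_diffP dfs := ds.
have H : (fun h : R => h^-1 *: (((fun y => s (dot w y)) \o shift x)
    (h *: delta_mx j 0) - s (dot w x)))
  = (fun h : R => h^-1 *: ((s \o shift (dot w x)) (h *: w j 0) - s (dot w x))).
  by apply/funext => h /=; rewrite dotD.
have dw : derivable s (dot w x) (w j 0) by exact: diff_derivable.
split; first by rewrite /derivable H.
rewrite /derive H -/(derive s (dot w x) (w j 0)) deriveE//.
move: (derive1E s (dot w x)); rewrite sl => <-.
by rewrite (deriv1E ds).
Qed.

End activation.

Section pde_operator.
Context {R : realType} {d : nat}.
Variables (A : 'cV[R]_d -> 'M[R]_d) (b : 'cV[R]_d -> 'cV[R]_d)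
  (c : 'cV[R]_d -> R).

Definition partial (u : 'cV[R]_d -> R) (j : 'I_d) (x : 'cV[R]_d) : R :=
  'D_(delta_mx j 0) u x.

Definition diffop (u : 'cV[R]_d -> R) (x : 'cV[R]_d) : R :=
  \sum_i \sum_j A x i j * partial (partial u i) j x
  + \sum_i b x i 0 * partial u i x + c x * u x.

(* The operator applied to the single neuron x |-> sigma (dot w x); see
   [pde_netE]. *)
Definition neuron (w x : 'cV[R]_d) : R :=
  dot w (A x *m w) * sigma2 (dot w x)
  + dot (b x) w * sigma1 (dot w x) + c x * sigma (dot w x).

Definition bounded_coefficients (M : R) : Prop := forall x, cube x ->
  [/\ forall i j, A x i j = A x j i,
      forall i j, `|A x i j| <= M,
      forall i, `|b x i 0| <= M
    & `|c x| <= M].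

End pde_operator.

Section network.
Context {R : realType} {d m : nat}.

(* The k-th row of a parameter matrix is (a_k, w_k^T). *)
Definition outer (theta : 'M[R]_(m, 1 + d)) (k : 'I_m) : R :=
  lsubmx theta k 0.
Definition inner (theta : 'M[R]_(m, 1 + d)) (k : 'I_m) : 'cV[R]_d :=
  (row k (rsubmx theta))^T.
Definition param (a : 'I_m -> R) (w : 'I_m -> 'cV[R]_d) : 'M[R]_(m, 1 + d) :=
  row_mx (\col_k a k) (\matrix_(k, j) w k j 0).

Definition net (theta : 'M[R]_(m, 1 + d)) (x : 'cV[R]_d) : R :=
  \sum_k outer theta k * sigma (dot (inner theta k) x).

Definition pde_net A b c (theta : 'M[R]_(m, 1 + d)) : 'cV[R]_d -> R :=
  diffop A b c (net theta).

Definition emp_risk A b c (f : 'cV[R]_d -> R) n (x : 'I_n -> 'cV[R]_d)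
    (theta : 'M[R]_(m, 1 + d)) : R :=
  (2 * n%:R)^-1 * \sum_i (pde_net A b c theta (x i) - f (x i)) ^+ 2.

Lemma outer_param (a : 'I_m -> R) (w : 'I_m -> 'cV[R]_d) k :
  outer (param a w) k = a k.
Proof. by rewrite /outer /param row_mxKl mxE. Qed.

Lemma inner_param (a : 'I_m -> R) (w : 'I_m -> 'cV[R]_d) k :
  inner (param a w) k = w k.
Proof.
by apply/colP => j; rewrite /inner /param row_mxKr !mxE.
Qed.

Lemma pde_netE A b c (theta : 'M[R]_(m, 1 + d)) x :
  pde_net A b c theta x =
  \sum_k outer theta k * neuron A b c (inner theta k) x.
Proof.
pose w k := inner theta k.
have part1 i : partial (net theta) i =
    fun y => \sum_k outer theta k * w k i 0 * sigma1 (dot (w k) y).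
  apply/funext => y; rewrite /partial.
  have H k : is_derive y (delta_mx i 0)
      (outer theta k \*: (fun y => sigma (dot (w k) y)))
      (outer theta k *: (w k i 0 * sigma1 (dot (w k) y))).
    by apply: is_deriveZ; apply/is_derive_dot/is_derive_sigma.
  have := is_derive_sum H => -[_ ].
  rewrite (_ : \sum_k _ = net theta); last by apply/funext => z; rewrite fct_sumE.
  by move=> ->; apply: eq_bigr => k _; rewrite -mulrA.
have part2 i j : partial (partial (net theta) i) j x =
    \sum_k outer theta k * w k i 0 * w k j 0 * sigma2 (dot (w k) x).
  rewrite part1 /partial.
  have H k : is_derive x (delta_mx j 0)
      ((outer theta k * w k i 0) \*: (fun y => sigma1 (dot (w k) y)))
      ((outer theta k * w k i 0) *: (w k j 0 * sigma2 (dot (w k) x))).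
    by apply: is_deriveZ; apply/is_derive_dot/is_derive_sigma1.
  have := is_derive_sum H => -[_ ].
  rewrite (_ : \sum_k _ = fun y => \sum_k outer theta k * w k i 0 *
    sigma1 (dot (w k) y)); last by apply/funext => z; rewrite fct_sumE.
  by move=> ->; apply: eq_bigr => k _; rewrite /GRing.scale/= !mulrA.
rewrite /pde_net /diffop.
under eq_bigr do under eq_bigr do rewrite part2 big_distrr/=.
under eq_bigr do rewrite exchange_big/=.
rewrite exchange_big/=.
under [X in _ + X + _]eq_bigr do rewrite part1 big_distrr/=.
rewrite [X in _ + X + _]exchange_big/=.
rewrite {1}/net [X in _ + X]big_distrr/= -!big_split/=; apply: eq_bigr => k _.
rewrite /neuron -/(w k) !mulrDr; congr (_ + _ + _); last by rewrite mulrCA.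
- rewrite {2}/dot mxE mulr_suml mulr_sumr; apply: eq_bigr => i _.
  rewrite !mxE mulr_sumr mulr_suml mulr_sumr; apply: eq_bigr => j _.
  by ring.
- rewrite {2}/dot mxE mulr_suml mulr_sumr; apply: eq_bigr => i _.
  by rewrite !mxE; ring.
Qed.

End network.

Section gradient_flow.
Context {R : realType} {p q : nat}.
Implicit Types (F : 'M[R]_(p, q) -> R) (theta : 'M[R]_(p, q)).

Definition grad F theta : 'M[R]_(p, q) :=
  \matrix_(i, j) 'D_(delta_mx i j) F theta.

Definition limiting_gradients F theta : set 'M[R]_(p, q) :=
  [set g | exists u : nat -> 'M[R]_(p, q),
    [/\ u @ \oo --> theta, forall k, differentiable F (u k)
      & (fun k => grad F (u k)) @ \oo --> g]].

(* Clarke's gradient of a locally Lipschitz function. It is {grad F theta}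
   wherever F is continuously differentiable. *)
Definition clarke_gradient F theta : set 'M[R]_(p, q) :=
  smallest (@convex_set R 'M[R]_(p, q)) (limiting_gradients F theta).

(* theta' = - grad F theta on [0, +oo[ in the sense of Caratheodory: theta is
   locally absolutely continuous, being the integral of v, and the equation
   holds for almost every time. The empirical risk involves sigma2, which has
   a kink at 0, so that it is only piecewise smooth in theta, and the gradient
   is read as Clarke's. This includes the flows obtained by giving the third
   derivative of sigma any value between 0 and 1 at the kink. *)
Definition gradient_flow F theta0 (theta : R -> 'M[R]_(p, q)) : Prop :=
  exists v : R -> 'M[R]_(p, q),
  [/\ forall i j t, 0 <= t ->
        lebesgue_measure.-integrable `[0, t] (fun s => (v s i j)%:E),
      forall i j t, 0 <= t -> theta t i j =
        theta0 i j + \int[lebesgue_measure]_(s in `[0, t]) v s i j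
    & {ae lebesgue_measure, forall s : R, 0 <= s ->
        clarke_gradient F (theta s) (- v s)}].

End gradient_flow.

Section gaussian_vector.
Context {R : realType}.

(* [normal_prob] lives on the alias [measurableTypeR R] of R, which has the
   same measurable sets. *)
Definition tuple_cons d (p : measurableTypeR R * d.-tuple R)
  : d.+1.-tuple R := [tuple of (p.1 : R) :: p.2].

Lemma measurable_tuple_cons d : measurable_fun setT (@tuple_cons d).
Proof.
apply: (@measurable_cons _ _ _ R (fst : measurableTypeR R * d.-tuple R -> R)).
  exact: (@measurable_fst _ _ (measurableTypeR R)).
exact: measurable_snd.
Qed.

HB.instance Definition _ d := isMeasurableFun.Build _ _ _ _ (@tuple_cons d)
  (@measurable_tuple_cons d).

(* The product measure N(0, 1)^d, i.e. N(0, I_d). *)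
Fixpoint std_gauss (d : nat) : probability (d.-tuple R) R :=
  match d with
  | 0 => \d_([tuple] : 0.-tuple R)
  | d'.+1 => distribution
      (normal_prob 0 1 \x std_gauss d')%E (@tuple_cons d')
  end.

End gaussian_vector.

Section independence.
Context d {T : measurableType d} {R : realType} (P : probability T R).

Definition mutually_independent (I : finType) (F : I -> set (set T)) : Prop :=
  forall (J : {set I}) (E : I -> set T), (forall i, i \in J -> F i (E i)) ->
  P (\bigcap_(i in [set` J]) E i) = (\prod_(i in J) P (E i))%E.

Definition generated d' {T' : measurableType d'} (X : T -> T')
  : set (set T) := preimage_set_system setT X measurable.

Definition has_law d' {T' : measurableType d'} (X : {RV P >-> T'})
    (mu : set T' -> \bar R) : Prop :=
  forall B, measurable B -> distribution P X B = mu B.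

Definition random_init D m (gamma : R) (a : 'I_m -> {RV P >-> R})
    (w : 'I_m -> {RV P >-> D.-tuple R}) : Prop :=
  [/\ forall k, has_law (a k) (normal_prob 0 gamma),
      forall k, has_law (w k) (std_gauss D)
    & mutually_independent (fun i : 'I_m + 'I_m =>
        match i with
        | inl k => generated (a k)
        | inr k => generated (w k)
        end)].

End independence.

Section kernel_matrix.
Context {R : realType} {d : nat}.
Variables (A : 'cV[R]_d -> 'M[R]_d) (b : 'cV[R]_d -> 'cV[R]_d)
  (c : 'cV[R]_d -> R).

Definition g_a (w x x' : 'cV[R]_d) : R := neuron A b c w x * neuron A b c w x'.

Definition k_a (x x' : 'cV[R]_d) : R :=
  fine 'E_(std_gauss d)[fun w => g_a (vec w) x x'].

Definition K_a n (x : 'I_n -> 'cV[R]_d) : 'M[R]_n :=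
  \matrix_(i, j) k_a (x i) (x j).

End kernel_matrix.

Definition C_norm1 (R : realType) (d : nat) : R :=
  fine 'E_(std_gauss d)[fun w : d.-tuple R => norm1 (vec w) ^+ 12].

(* Main.v *)
(** As long as no parameter has drifted by more than r, the Gram matrix of the
    neurons is entrywise within lambda/(2n) of its expectation K, so the outer
    weights alone contribute at most -(m lambda/n) R_S to the derivative of R_S.
    Hence R_S decays exponentially, every parameter moves at a speed of order
    sqrt R_S, and the total drift is strictly less than r: a continuity argument
    in t closes the loop.

    The second derivative of the activation has a kink at 0, and the flow is only
    driven by Clarke gradients. A Clarke gradient can be replaced by an ordinary
    derivative when paired with a direction that does not move any product
    w_k . x_i lying at the kink, and the velocity of the flow is such a direction
    at almost every time, because the zeros of t |-> w_k(t) . x_i with nonzero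
    derivative are isolated.

    At initialization, Chernoff bounds control the parameters, and Chebyshev's
    inequality with the moment E |w|_1^12 controls the entries of the Gram matrix. *)

Require Import Defs.
From HB Require Import structures.
From mathcomp Require Import all_boot all_order all_algebra.
From mathcomp Require Import all_classical all_reals all_analysis.
From mathcomp Require Import measurable_realfun.
From mathcomp Require Import ring lra.

Import Order.TTheory GRing.Theory Num.Theory.
Import numFieldNormedType.Exports.

Local Open Scope classical_set_scope.
Local Open Scope ring_scope.

(** * Continuity and the Rayleigh quotient *)

(** Half of the least eigenvalue is spent without affecting the rate: the squared residuals sum to 2
    n R_S, so a Gram form bounded below by m lambda / 2 already gives m lambda / n. The spent half
    is shared equally between the sampling error at time 0 and the drift, lambda / (4 n) per entry
    for each.

    The differential inequalities hold only at almost every time, and a continuous function with a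
    nonpositive derivative almost everywhere may still increase, as Cantor's function does. Every
    function of time involved is therefore dominated by increments of a single integral, that of
    [speed]; this property is stable under the operations that build the risk and the exponential
    weights.

    The kink also limits the directions in which a Clarke gradient can be tested. Coordinate
    directions of w_k may be irregular, but the part of the velocity that belongs to one neuron is
    regular, as is any direction moving only outer weights. Testing these is enough to compute the
    outer velocity and to bound the inner one. *)

Lemma continuous_at_sum (R : numFieldType) (V : normedModType R)
    (T : topologicalType) (I : Type) (r : seq I) (P : pred I)
    (f : I -> T -> V) (x : T) :
  (forall i, P i -> {for x, continuous (f i)}) ->
  {for x, continuous (fun y => \sum_(i <- r | P i) f i y)}.
Proof. by move=> fx; apply: cvg_big => //; exact: add_continuous. Qed.

Section rayleigh.
Context {R : realType} {n : nat}.
Implicit Types (K : 'M[R]_n) (v u : 'rV[R]_n).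

Let q K v : R := (v *m K *m v^T) 0 0.

Lemma row_formE K v :
  (v *m K *m v^T) 0 0 = \sum_i \sum_j v 0 i * v 0 j * K i j.
Proof.
rewrite mxE exchange_big /=; apply: eq_bigr => j _.
rewrite !mxE mulr_suml; apply: eq_bigr => i _.
by rewrite mulrAC.
Qed.

Lemma sqnorm_eq0 v : \sum_i v 0 i ^+ 2 = 0 -> v = 0.
Proof.
move=> /eqP; rewrite psumr_eq0 => [/allP v0|i _]; last exact: sqr_ge0.
apply/rowP => i; rewrite mxE; apply/eqP; rewrite -sqrf_eq0.
by have := v0 i (mem_index_enum i).
Qed.

Lemma row_form_continuous K : continuous (q K).
Proof.
rewrite /q => v; under eq_fun do rewrite row_formE.
apply: continuous_at_sum => i _; apply: continuous_at_sum => j _.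
apply: continuousM; last exact: cst_continuous.
by apply: continuousM; exact: coord_continuous.
Qed.

Lemma unit_sphere_compact : compact [set v : 'rV[R]_n | \sum_i v 0 i ^+ 2 = 1].
Proof.
apply: bounded_closed_compact; last first.
  rewrite (_ : [set v | _] = (fun v => \sum_i v 0 i ^+ 2) @^-1` [set 1])//.
  apply: preimage_closed; last exact: closed_eq.
  move=> v _; apply: continuous_at_sum => i _.
  by apply: (@continuous_comp _ _ _ (fun u : 'rV[R]_n => u 0 i) (fun y => y ^+ 2));
    [exact: coord_continuous|exact: exprn_continuous].
  exists 1; split => // x x1 v /= v1.
  apply/ltW; apply: le_lt_trans x1; rewrite {1}/Num.norm /= mx_normrE.
  apply/bigmax_leP; split => //= -[i j] _ /=; rewrite ord1.
  rewrite -(@ler_pXn2r _ 2)// ?nnegrE// expr1n real_normK ?num_real// -v1.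
  by rewrite (bigD1 j)//= lerDl sumr_ge0// => k _; exact: sqr_ge0.
Qed.

(* The minimum of the Rayleigh quotient is attained, and its minimizer is an
   eigenvector by the first-order condition. *)
Lemma lambda_min_rayleigh K v : K^T = K ->
  lambda_min K * \sum_i v 0 i ^+ 2 <= \sum_i \sum_j v 0 i * v 0 j * K i j.
Proof.
move=> Ksym; rewrite -row_formE.
have [->|v0] := eqVneq v 0.
  by rewrite mul0mx mul0mx big1 ?mulr0 ?mxE// => i _; rewrite mxE expr0n.
have normalize u : u != 0 ->
    exists2 s, 0 < s & \sum_i u 0 i ^+ 2 = s ^+ 2.
  move=> u0; have S0 : 0 < \sum_i u 0 i ^+ 2.
    rewrite lt_neqAle sumr_ge0 ?andbT// => [|i _]; last exact: sqr_ge0.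
    by apply: contra_neq u0 => /esym; exact: sqnorm_eq0.
  by exists (Num.sqrt (\sum_i u 0 i ^+ 2)); rewrite ?sqrtr_gt0// sqr_sqrtr// ltW.
have unit u s : 0 < s -> \sum_i u 0 i ^+ 2 = s ^+ 2 ->
    \sum_i (s^-1 *: u) 0 i ^+ 2 = 1.
  move=> s0 us; under eq_bigr do rewrite mxE exprMn.
  by rewrite -mulr_sumr us -exprMn mulVf ?expr1n// gt_eqF.
have qZ u s : q K (s *: u) = s ^+ 2 * q K u.
  by rewrite /q -scalemxAl -scalemxAl linearZ/= -scalemxAr 2!mxE; ring.
have [s s0 vs] := normalize v v0.
have [] := @EVT_min_rV R n (q K) [set u | \sum_i u 0 i ^+ 2 = 1].
- by exists (s^-1 *: v); exact: unit.
- exact: unit_sphere_compact.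
- by apply: continuous_subspaceT; exact: row_form_continuous.
move=> z; rewrite inE /= => z1 zmin; set mu := q K z in zmin.
have ge_mu u : mu * \sum_i u 0 i ^+ 2 <= q K u.
  have [->|u0] := eqVneq u 0.
    by rewrite /q mul0mx mul0mx big1 ?mulr0 ?mxE// => i _; rewrite mxE expr0n.
  have [r r0 ur] := normalize u u0.
  have := zmin (r^-1 *: u); rewrite inE => /(_ (unit _ _ r0 ur)).
  by rewrite -/mu qZ ur exprVn ler_pdivlMl ?exprn_gt0// mulrC.
have expand u1 u2 t : q K (u1 + t *: u2) = q K u1 + t * (u2 *m K *m u1^T) 0 0
    + t * (u1 *m K *m u2^T) 0 0 + t ^+ 2 * q K u2.
  have -> : q K (u1 + t *: u2) =
      ((u1 + t *: u2) *m K *m (u1^T + t *: u2^T)) 0 0.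
    by congr ((_ *m _) 0 0); apply/matrixP => i j; rewrite !mxE.
  rewrite /q !mulmxDl !mulmxDr -!scalemxAl -!scalemxAr.
  have entZ (B C D F : 'M[R]_1) : (B + t *: C + (t *: D + t *: (t *: F))) 0 0
      = B 0 0 + t * D 0 0 + t * C 0 0 + t ^+ 2 * F 0 0.
    by rewrite !mxE; ring.
  by rewrite entZ.
have nexpand u1 u2 t : \sum_i (u1 + t *: u2) 0 i ^+ 2 =
    \sum_i u1 0 i ^+ 2 + 2 * t * (u1 *m u2^T) 0 0 + t ^+ 2 * \sum_i u2 0 i ^+ 2.
  rewrite [(_ *m _) _ _]mxE !mulr_sumr -!big_split/=; apply: eq_bigr => i _.
  by rewrite !mxE; ring.
(* Half the gradient at [z] of the nonnegative form q(u) - mu |u|^2, which vanishes at [z]. A step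
   along [- w] would make this form negative unless [w] = 0. *)
pose w := z *m K - mu *: z.
have zw : z *m K = mu *: z.
  apply/eqP; rewrite -subr_eq0 -/w; apply/eqP/sqnorm_eq0.
  set N := \sum_i _; pose D := q K w - mu * N.
  have D0 : 0 <= D by rewrite subr_ge0 ge_mu.
  have entD (B C : 'M[R]_1) s' : (B - s' *: C) 0 0 = B 0 0 - s' * C 0 0.
    by rewrite !mxE.
  have cross t : 0 <= 2 * t * N + t ^+ 2 * D.
    have := ge_mu (z + t *: w); rewrite -subr_ge0.
    have zKw : (z *m K *m w^T) 0 0 - mu * (z *m w^T) 0 0 = N.
      rewrite -entD scalemxAl -mulmxBl -/w mxE /N.
      by apply: eq_bigr => i _; rewrite [w^T _ _]mxE expr2.
    have wKz : (w *m K *m z^T) 0 0 = (z *m K *m w^T) 0 0.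
      have trE (B : 'M[R]_1) : B 0 0 = B^T 0 0 by rewrite mxE.
      by rewrite trE !trmx_mul trmxK Ksym mulmxA.
    rewrite expand.
    rewrite nexpand z1.
    rewrite -/mu wKz => /le_trans; apply.
    have zKw' : (z *m K *m w^T) 0 0 = N + mu * (z *m w^T) 0 0.
      by rewrite -zKw subrK.
    by rewrite le_eqVlt; apply/orP; left; apply/eqP; rewrite /D -/N zKw'; ring.
  have N0 : 0 <= N by apply: sumr_ge0 => i _; exact: sqr_ge0.
  apply/eqP; rewrite eq_le N0 andbT leNgt; apply/negP => Npos.
  have D1 : D + 1 != 0 by rewrite gt_eqF// ltr_wpDl.
  (* The step [- t] gives - 2 t N + t^2 D = - t^2 (D + 2) < 0. The denominator [D + 1] covers the
     case D = 0. *)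
  pose t := N / (D + 1); have t0 : 0 < t by rewrite divr_gt0// ltr_wpDl.
  have Nt : N = t * (D + 1) by rewrite divfK.
  have := cross (- t); rewrite Nt leNgt.
  have -> : 2 * - t * (t * (D + 1)) + (- t) ^+ 2 * D = - (t ^+ 2 * (D + 2)).
    by ring.
  by rewrite oppr_lt0 mulr_gt0 ?exprn_gt0// ltr_wpDl.
apply: le_trans (ge_mu v); rewrite ler_wpM2r ?sumr_ge0// => [i _|].
  exact: sqr_ge0.
rewrite /lambda_min; apply: ge_inf.
  exists mu => a /= /eigenvalueP[u uK u0].
  have [r r0 ur] := normalize u u0.
  have := ge_mu u; rewrite /q uK -scalemxAl mxE ur.
  have -> : (u *m u^T) 0 0 = r ^+ 2.
    by rewrite -ur mxE; apply: eq_bigr => i _; rewrite mxE expr2.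
  by rewrite ler_pM2r// exprn_gt0.
apply/eigenvalueP; exists z => //; apply/eqP => z0.
move: z1; rewrite z0 big1 => [/eqP|i _]; first by rewrite eq_sym oner_eq0.
by rewrite mxE expr0n.
Qed.

End rayleigh.

(** * Absolutely continuous functions *)

(** Consider the infimum of the failures: the hypothesis yields P on an interval that starts at this
    point and includes it, which pushes the infimum further right. No base case is needed, since
    nothing precedes [a]. *)
Lemma real_induction (R : realType) (a : R) (P : R -> Prop) :
  (forall t, a <= t -> (forall s, a <= s < t -> P s) ->
    exists2 e, 0 < e & forall s, t <= s < t + e -> P s) ->
  forall t, a <= t -> P t.
Proof.
move=> ind t at_; apply: contrapT => Pt.
pose B := [set s | a <= s /\ ~ P s].
have B0 : B !=set0 by exists t.
have lbB : has_lbound B by exists a => s [].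
have am : a <= inf B by apply: lb_le_inf => // s [].
have [|e e0 Pe] := ind (inf B) am.
  move=> s /andP[as_ sm]; apply: contrapT => Ps.
  by move: sm; rewrite ltNge (ge_inf lbB (conj as_ Ps)).
have : inf B + e <= inf B.
  apply: lb_le_inf => // s [as_ Ps]; rewrite leNgt; apply/negP => se.
  by apply: (Ps); apply: Pe; rewrite se andbT (ge_inf lbB (conj as_ Ps)).
by rewrite gerDl leNgt e0.
Qed.

Section absolutely_continuous.
Context {R : realType}.
Notation mu := (@lebesgue_measure R).

(** Absolute continuity of the integral, applied to [u] extended by 0 outside [D]. *)
Lemma small_integral (u : R -> R) (D : set R) (e : R) :
  measurable D -> mu.-integrable D (EFin \o u) -> 0 < e ->
  exists2 d, 0 < d & forall A, measurable A -> A `<=` D -> (mu A < d%:E)%E ->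
    \int[mu]_(x in A) u x < e.
Proof.
move=> mD intu e0.
have : mu.-integrable setT (EFin \o u \_ D).
  by rewrite -restrict_EFin; apply/integrable_restrict => //=; rewrite setTI.
move=> /integral_normr_continuous /(_ _ e0)[d [d0 ud]].
exists d => // A mA AD mAd; apply: le_lt_trans (ud _ mA mAd).
have intA : mu.-integrable A (EFin \o u) by exact: integrableS intu.
rewrite [leRHS](_ : _ = \int[mu]_(x in A) `|u x|); last first.
  by apply: eq_Rintegral => x; rewrite inE => /AD Dx; rewrite patchE mem_set.
by apply: le_trans (le_normr_Rintegral _ _) => //; exact: ler_norm.
Qed.

Variables (u : R -> R) (T C : R).
Hypotheses (T0 : 0 <= T) (C0 : 0 <= C) (u0 : forall x, 0 <= u x).
Hypothesis intu : mu.-integrable `[0, T] (EFin \o u).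

Let RintegralU A B : measurable A -> measurable B -> [disjoint A & B] ->
  A `<=` `[0, T] -> B `<=` `[0, T] ->
  \int[mu]_(x in A `|` B) u x = \int[mu]_(x in A) u x + \int[mu]_(x in B) u x.
Proof.
move=> mA mB AB AT BT; apply: Rintegral_setU => //.
apply: integrableS intu => //; first exact: measurableU.
by rewrite subUset.
Qed.

(* A null set of bad times is covered by an open set carrying a small part of
   the integral of u; real induction then bounds h by this part plus an
   arbitrarily small slope. *)
Lemma ae_nonincreasing (h : R -> R) :
  (forall s t, 0 <= s -> s <= t -> t <= T ->
    `|h t - h s| <= C * \int[mu]_(x in `]s, t]) u x) ->
  {ae mu, forall t, 0 < t < T -> exists2 l, is_derive t 1 h l & l <= 0} ->
  h T <= h 0.
Proof.
move=> hu [N0 [mN0 N00 badN0]].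
have itvS (s t : R) : 0 <= s -> t <= T -> `]s, t] `<=` `[0, T].
  move=> s0 tT x; rewrite /= !in_itv/= => /andP[sx xt].
  by rewrite (le_trans s0 (ltW sx)) (le_trans xt).
apply/ler_addgt0Pr => e e0.
(* The slope [e1] costs at most e1 T in total and the cover of the bad times at most C e1, together
   less than e. *)
pose e1 := e / (T + C + 1).
have TC0 : 0 < T + C + 1 by rewrite ltr_wpDl// addr_ge0.
have e10 : 0 < e1 by rewrite divr_gt0.
have [d d0 small] := @small_integral u _ _ (measurable_itv _) intu e10.
(* Time 0 is counted as bad because the derivative is only known inside ]0, T[. *)
pose N := (N0 `|` [set 0]) `&` `[0, T].
have mN : measurable N by apply: measurableI => //; exact: measurableU.
have muN : mu N = 0%E.
  apply/eqP; rewrite eq_le measure_ge0 andbT.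
  apply: (@le_trans _ _ (mu (N0 `|` [set 0]))).
    by apply: le_measure; rewrite ?inE//; [exact: measurableU|exact: subIsetl].
  apply: le_trans (measureU2 _ _ _) _ => //.
  rewrite [X in (X + _ <= _)%E](N00 : mu N0 = 0%E) add0e.
  by have /= -> := lebesgue_measure_set1 (0 : R).
have [|V [oV NV muV]] := lebesgue_regularity_outer mN _ d0.
  by rewrite [ltLHS]muN.
have mV : measurable V by exact: open_measurable.
have {}muV : (mu V < d%:E)%E.
  apply: le_lt_trans muV; rewrite -{1}(setDUK NV).
  apply: le_trans (measureU2 _ _ _) _ => //; first exact: measurableD.
  by rewrite [X in (X + _ <= _)%E]muN add0e.
(* [psi t] is the share of the integral of [u] carried up to time t by the open cover [V] of the bad
   times. *)
pose W t := `[0, t] `&` V; pose psi t := \int[mu]_(x in W t) u x.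
have mW t : measurable (W t) by exact: measurableI.
have WT t : t <= T -> W t `<=` `[0, T].
  by move=> tT x [/=]; rewrite !in_itv/= => /andP[-> /le_trans->].
have psiD s t : 0 <= s -> s <= t -> t <= T ->
    psi t = psi s + \int[mu]_(x in `]s, t] `&` V) u x.
  move=> s0 st tT; rewrite /psi -RintegralU//.
  - congr Rintegral; rewrite /W -setIUl; congr (_ `&` _).
    by rewrite -itv_bndbnd_setU.
  - exact: measurableI.
  - apply/disj_set2P; rewrite -subset0 => x [[/= + _] [/= + _]].
    by rewrite !in_itv/= => /andP[_ xs] /andP[]; rewrite ltNge xs.
  - by apply: WT; exact: le_trans tT.
  - by move=> x [/(itvS _ _ s0 tT)].
have psi_nd s t : 0 <= s -> s <= t -> t <= T -> psi s <= psi t.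
  by move=> s0 st tT; rewrite (psiD s t)// lerDl; exact: Rintegral_ge0.
have key t : 0 <= t -> t <= T -> h t <= h 0 + e1 * t + C * psi t.
  apply: (@real_induction R 0 (fun t => t <= T -> h t <= h 0 + e1 * t + C * psi t)).
  move=> {}t t0 IH.
  have [tT|Tt] := ltP T t.
    by exists 1 => // s /andP[ts _] /(le_trans ts); rewrite leNgt tT.
  (* The bound passes to the left limit: between t and a slightly earlier s, h moves by less than
     any prescribed r. *)
  have ht : h t <= h 0 + e1 * t + C * psi t.
    move: t0; rewrite le_eqVlt => /predU1P[<-|t0].
      rewrite mulr0 addr0 lerDl mulr_ge0// Rintegral_ge0// => x _; exact: u0.
    apply/ler_addgt0Pr => r r0.
    have [d1 d10 small1] := @small_integral u _ (r / (C + 1))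
      (measurable_itv _) intu (divr_gt0 r0 (ltr_wpDl C0 ltr01)).
    pose s := Num.max 0 (t - d1 / 2).
    have s0 : 0 <= s by rewrite le_max lexx.
    have st : s < t by rewrite gt_max t0 ltrBlDr ltrDl divr_gt0.
    have := IH s; rewrite s0 st => /(_ isT (le_trans (ltW st) Tt)) hs.
    have := hu s t s0 (ltW st) Tt => /(le_trans (ler_norm _)).
    rewrite lerBlDr => /le_trans; apply.
    have : C * \int[mu]_(x in `]s, t]) u x <= r.
      apply: (@le_trans _ _ (C * (r / (C + 1)))).
        rewrite ler_wpM2l// ltW// small1//; first exact: itvS.
        rewrite lebesgue_measure_itv/= lte_fin st -EFinB lte_fin.
        have : t - d1 / 2 <= s by rewrite le_max lexx orbT.
        by have := d10; lra.
      by rewrite mulrA ler_pdivrMr ?ltr_wpDl// mulrC ler_wpM2l ?ltW//; lra.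
    have := ler_wpM2l C0 (psi_nd s t s0 (ltW st) Tt).
    have : e1 * s <= e1 * t by rewrite ler_wpM2l// ltW.
    by move: hs; lra.
  move: Tt; rewrite le_eqVlt => /predU1P[tT|tT].
    exists 1 => // s /andP[ts _] sT; have -> : s = t; last exact: ht.
    by apply/eqP; rewrite eq_le ts tT sT.
  (* At a bad time the interval just after t lies in [V], so the growth of h is charged to [psi]. At
     a good time the difference quotient is eventually at most [e1]. *)
  have [Nt|Nt] := pselect (N t).
    have := NV _ Nt => /(oV) => -[r /= r0 rV].
    exists r => // s /andP[ts str] sT.
    have subV : `]t, s] `<=` V.
      move=> x; rewrite /= in_itv/= => /andP[tx xs]; apply: rV.
      by rewrite /ball/= ltr0_norm; lra.
    have := hu t s t0 ts sT => /(le_trans (ler_norm _)).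
    rewrite lerBlDr => /le_trans; apply.
    rewrite (psiD t s)// setIidl// mulrDr.
    have : e1 * t <= e1 * s by rewrite ler_wpM2l// ltW.
    move: ht; lra.
  have t0' : 0 < t.
    rewrite lt_neqAle t0 andbT; apply/eqP => t00; apply: Nt; split.
      by right; rewrite /= t00.
    by rewrite /= in_itv/= -t00 lexx.
  have [l [hd hl] l0] : exists2 l, is_derive t 1 h l & l <= 0.
    apply: contrapT => bad; apply: Nt; split; last first.
      by rewrite /= in_itv/= t0 ltW.
    left; apply: badN0 => /=; apply: contra_not bad; apply.
    by rewrite t0' tT.
  have := hd; rewrite /derivable => /cvg_ex[/= l' hl'].
  have l'E : l' = l by rewrite -hl /derive; apply/esym/cvg_lim.
  rewrite l'E in hl'.
  move/cvgrPdist_le : hl' => /(_ e1 e10)/=.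
  move=> [r /= r0 hr]; exists r => // s /andP[ts str] sT.
  move: ts; rewrite le_eqVlt => /predU1P[<-//|ts].
  have := hr (s - t); rewrite /ball/= sub0r normrN gtr0_norm ?subr_gt0//.
  rewrite ltrBlDr addrC => /(_ str); rewrite subr_eq0 gt_eqF// => /(_ isT).
  rewrite [(_ - _) *: 1]mulr1 subrK distrC => /(le_trans (ler_norm _)).
  rewrite lerBlDr => hs.
  have {}hs : (s - t)^-1 * (h s - h t) <= e1 by apply: le_trans hs _; lra.
  rewrite ler_pdivrMl ?subr_gt0// in hs.
  have := psi_nd t s t0 (ltW ts) sT => /(ler_wpM2l C0).
  move: ht hs; lra.
apply: le_trans (key T T0 (lexx _)) _.
rewrite -addrA lerD2l.
have : C * psi T <= C * e1.
  rewrite ler_wpM2l// ltW// small//; first exact: WT.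
  apply: le_lt_trans muV; apply: le_measure; rewrite ?inE//; last exact: subIsetr.
  exact: mW.
have -> : e = e1 * (T + C + 1) by rewrite divfK// gt_eqF.
have := e10; nra.
Qed.

End absolutely_continuous.

Lemma is_derive_bigsum (R : realType) (I : finType) (f : I -> R -> R)
    (df : I -> R) (t : R) :
  (forall i, is_derive t 1 (f i) (df i)) ->
  is_derive t 1 (fun s => \sum_i f i s) (\sum_i df i).
Proof.
move=> fdf; elim: (index_enum I) => [|i r IH].
  by under eq_fun do rewrite big_nil; rewrite big_nil; exact: is_derive_cst.
under eq_fun do rewrite big_cons; rewrite big_cons.
exact: (is_deriveD (fdf i) IH).
Qed.

(** * Functions whose increments are dominated by a gauge *)

Section gauge.
Context {R : realType}.
Variables (T B : R) (G : R -> R -> R).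
Hypothesis GB : forall s t, 0 <= s -> s <= t -> t <= T -> 0 <= G s t <= B.
Implicit Types h : R -> R.

(* Absolute continuity with respect to G, in a form that is stable under sums
   and products. *)
Definition gauged h := exists2 C, 0 <= C &
  forall s t, 0 <= s -> s <= t -> t <= T -> `|h t - h s| <= C * G s t.

Lemma gauged_cst a : gauged (fun=> a).
Proof. by exists 0 => // s t _ _ _; rewrite subrr normr0 mul0r. Qed.

Lemma gauged_bounded h : gauged h ->
  exists2 K, 0 <= K & forall t, 0 <= t -> t <= T -> `|h t| <= K.
Proof.
move=> [C C0 hC]; exists (`|h 0| + C * Num.max B 0).
  by rewrite addr_ge0// mulr_ge0// le_max lexx orbT.
move=> t t0 tT; rewrite -[h t](subrK (h 0)) addrC.
apply: le_trans (ler_normD _ _) _; rewrite lerD2l.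
apply: le_trans (hC _ _ (lexx _) t0 tT) _; rewrite ler_wpM2l//.
by rewrite le_max; have /andP[_ ->] := GB _ _ (lexx 0) t0 tT.
Qed.

Lemma gaugedD h1 h2 : gauged h1 -> gauged h2 -> gauged (fun t => h1 t + h2 t).
Proof.
move=> [C1 C10 hC1] [C2 C20 hC2]; exists (C1 + C2); first exact: addr_ge0.
move=> s t s0 st tT; rewrite opprD addrACA mulrDl.
by apply: le_trans (ler_normD _ _) _; rewrite lerD ?hC1 ?hC2.
Qed.

Lemma gaugedM h1 h2 : gauged h1 -> gauged h2 -> gauged (fun t => h1 t * h2 t).
Proof.
move=> g1 g2; have [K1 K10 hK1] := gauged_bounded _ g1.
have [K2 K20 hK2] := gauged_bounded _ g2.
case: g1 g2 => [C1 C10 hC1] [C2 C20 hC2].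
exists (K1 * C2 + C1 * K2); first by rewrite addr_ge0// mulr_ge0.
move=> s t s0 st tT; have t0 := le_trans s0 st; have sT := le_trans st tT.
have /andP[G0 _] := GB _ _ s0 st tT.
rewrite (_ : _ - _ = h1 t * (h2 t - h2 s) + (h1 t - h1 s) * h2 s); last by ring.
apply: le_trans (ler_normD _ _) _; rewrite !normrM mulrDl lerD//.
  by rewrite -mulrA ler_pM// ?hK1 ?hC2.
by rewrite mulrAC ler_pM// ?hC1 ?hK2.
Qed.

Lemma gauged_sum (I : finType) (f : I -> R -> R) :
  (forall i, gauged (f i)) -> gauged (fun t => \sum_i f i t).
Proof.
move=> gf; elim: (index_enum I) => [|i r IH].
  by under eq_fun do rewrite big_nil; exact: gauged_cst.
by under eq_fun do rewrite big_cons; exact: gaugedD.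
Qed.

Lemma gauged_sigma2 h : gauged h -> gauged (fun t => sigma2 (h t)).
Proof.
move=> [C C0 hC]; exists C => // s t s0 st tT.
apply: le_trans (hC s t s0 st tT); rewrite !sigma2E.
have n1 := ler_norm (h t - h s); have n2 := ler_norm (- (h t - h s)).
rewrite normrN in n2; move: (`|h t - h s|) n1 n2 => y n1 n2.
by rewrite ler_norml; case: (leP 0 (h t)) => ?; case: (leP 0 (h s)) => ?; apply/andP; split; lra.
Qed.

End gauge.

(** * Differentiating a neuron along a curve of weights *)

Section neuron_calculus.
Context {R : realType} {d : nat}.
Variables (A : 'cV[R]_d -> 'M[R]_d) (b : 'cV[R]_d -> 'cV[R]_d)
  (c : 'cV[R]_d -> R) (x : 'cV[R]_d).
Implicit Types u v w : 'cV[R]_d.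

Lemma dotE u v : dot u v = \sum_j u j 0 * v j 0.
Proof. by rewrite /dot mxE; apply: eq_bigr => j _; rewrite mxE. Qed.

Lemma dotBl u v w : dot (u - v) w = dot u w - dot v w.
Proof.
rewrite !dotE -sumrB; apply: eq_bigr => j _.
by rewrite !mxE mulrBl.
Qed.

Definition aform u v : R := \sum_i \sum_j u i 0 * A x i j * v j 0.

Lemma aformE u v : dot u (A x *m v) = aform u v.
Proof.
rewrite dotE; apply: eq_bigr => i _; rewrite mxE mulr_sumr.
by apply: eq_bigr => j _; rewrite mulrA.
Qed.

Lemma sigma1_sigma2 (z : R) : sigma1 z = sigma2 z ^+ 2 / 2.
Proof. by rewrite /sigma1 sigma2E; case: ifP => // _; rewrite expr0n mul0r. Qed.

Lemma sigma_sigma2 (z : R) : sigma z = sigma2 z ^+ 3 / 6.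
Proof. by rewrite sigmaE sigma2E; case: ifP => // _; rewrite expr0n mul0r. Qed.

(** All three activations become powers of [sigma2], so the kink enters through a single 1-Lipschitz
    function. *)
Lemma neuronE w : neuron A b c w x =
  aform w w * sigma2 (dot w x) + dot (b x) w * (sigma2 (dot w x) ^+ 2 / 2)
  + c x * (sigma2 (dot w x) ^+ 3 / 6).
Proof. by rewrite /neuron aformE sigma1_sigma2 sigma_sigma2. Qed.

(** The value at 0 is a convention: for a regular direction it is multiplied by [dot v x] = 0. *)
Definition heaviside (z : R) : R := if 0 < z then 1 else 0.

(* The derivative of [neuron] in the direction v, which is genuine at w when
   dot w x != 0 or dot v x = 0. *)
Definition dneuron w v : R :=
  let s := sigma2 (dot w x) in let s' := heaviside (dot w x) * dot v x in
  (aform v w + aform w v) * s + aform w w * s' + dot (b x) v * (s ^+ 2 / 2)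
  + dot (b x) w * (s * s') + c x * (s ^+ 2 / 2 * s').

Definition regular w v := dot w x = 0 -> dot v x = 0.

Lemma is_derive_sigma2 (h : R -> R) (t l : R) :
  is_derive t 1 h l -> (h t = 0 -> l = 0) ->
  is_derive t 1 (fun s => sigma2 (h s)) (heaviside (h t) * l).
Proof.
move=> dh hl; have hc : {for t, continuous h}.
  by apply: differentiable_continuous; apply/derivable1_diffP.
rewrite /heaviside.
have [ht|ht|ht] := ltgtP (h t) 0.
- rewrite mul0r; apply: (@near_eq_is_derive _ _ _ (cst 0)).
  near=> s; rewrite /sigma2 max_r//.
  apply: ltW; near: s; exact: (cvgr_lt (h t)).
- rewrite mul1r; apply: (@near_eq_is_derive _ _ _ h) => //.
  near=> s; rewrite /sigma2 max_l//.
  apply: ltW; near: s; exact: (cvgr_gt (h t)).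
(* At the kink |sigma2 y| <= |y|, so the difference quotient of the composition is dominated by that
   of [h], which tends to 0. *)
have l0 := hl ht; rewrite mul0r.
have /cvgrPdist_le H : (fun e : R => e^-1 *: (h (e *: 1 + t) - h t)) @ 0^' --> (0 : R).
  have [/cvg_ex[/= l' hl''] E] := dh.
  have l'0 : l' = 0 by rewrite -l0 -E /derive; apply/esym/cvg_lim.
  by rewrite l'0 in hl''.
have K : (fun e : R => e^-1 *: (sigma2 (h (e *: 1 + t)) - sigma2 (h t))) @ 0^' --> (0 : R).
  apply/cvgrPdist_le => e e0; have := H e e0; apply: filterS => y.
  rewrite ht !sub0r !normrN !normrZ subr0; apply: le_trans.
  rewrite ler_wpM2l// /sigma2 maxxx subr0.
  by case: (leP _ 0) => // _; rewrite normr0.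
split; first by apply/cvg_ex; exists 0.
by rewrite /derive; apply: cvg_lim.
Unshelve. all: by end_near. Qed.

Section curve.
Variables (w : R -> 'cV[R]_d) (v : 'cV[R]_d) (t : R).
Hypothesis dw : forall j, is_derive t 1 (fun s => w s j 0) (v j 0).

Lemma is_derive_neuron : regular (w t) v ->
  is_derive t 1 (fun s => neuron A b c (w s) x) (dneuron (w t) v).
Proof.
move=> reg; under eq_fun do rewrite neuronE.
have dz : is_derive t 1 (fun s => dot (w s) x) (dot v x).
  under eq_fun do rewrite dotE; rewrite dotE.
  apply: is_derive_bigsum => j.
  have -> : (fun s => w s j 0 * x j 0) = (fun s => w s j 0) * cst (x j 0) by [].
  by apply: is_derive_eq; rewrite scaler0 add0r mulrC.
have dl : is_derive t 1 (fun s => dot (b x) (w s)) (dot (b x) v).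
  under eq_fun do rewrite dotE; rewrite dotE.
  exact: is_derive_bigsum.
have dq : is_derive t 1 (fun s => aform (w s) (w s)) (aform v (w t) + aform (w t) v).
  rewrite /aform -big_split/=; apply: is_derive_bigsum => i.
  rewrite -big_split/=; apply: is_derive_bigsum => j.
  have -> : (fun s => w s i 0 * A x i j * w s j 0) =
    (fun s => w s i 0) * cst (A x i j) * (fun s => w s j 0) by [].
  apply: is_derive_eq; rewrite scaler0 add0r /GRing.scale/=.
  rewrite -[X in X * v j 0]/(w t i 0 * A x i j); ring.
have ds := is_derive_sigma2 _ _ _ dz reg.
set s' := heaviside _ * _ in ds.
pose q s := aform (w s) (w s); pose l s := dot (b x) (w s).
pose g s := sigma2 (dot (w s) x).
have -> : (fun s => aform (w s) (w s) * sigma2 (dot (w s) x)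
    + dot (b x) (w s) * (sigma2 (dot (w s) x) ^+ 2 / 2)
    + c x * (sigma2 (dot (w s) x) ^+ 3 / 6))
  = q * g + 2^-1 *: (l * (g * g)) + (c x / 6) *: (g * (g * g)).
  apply/funext => s.
  rewrite -[RHS]/(q s * g s + 2^-1 * (l s * (g s * g s))
    + c x / 6 * (g s * (g s * g s))).
  by rewrite -/(q s) -/(l s) -/(g s); field.
have dq' : is_derive t 1 q (aform v (w t) + aform (w t) v) := dq.
have dl' : is_derive t 1 l (dot (b x) v) := dl.
have dg' : is_derive t 1 g s' := ds.
apply: (is_derive_eq (is_deriveD (is_deriveD (is_deriveM dq' dg')
  (is_deriveZ 2^-1 (is_deriveM dl' (is_deriveM dg' dg'))))
  (is_deriveZ (c x / 6) (is_deriveM dg' (is_deriveM dg' dg'))))).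
rewrite /dneuron -/s' -/(g t) -/(l t) -/(q t).
by rewrite -[(g * g) t]/(g t * g t) /GRing.scale/=; field.
Qed.

End curve.
End neuron_calculus.

(** * Neurons and their derivatives *)

Lemma ler_normM (R : realDomainType) (a b K L : R) :
  `|a| <= K -> `|b| <= L -> `|a * b| <= K * L.
Proof. by move=> aK bL; rewrite normrM ler_pM. Qed.

Section norm1.
Context {R : realType} {d : nat}.
Implicit Types u v w : 'cV[R]_d.

Lemma norm1_ge0 u : 0 <= norm1 u.
Proof. exact: sumr_ge0. Qed.

Lemma coord_le_norm1 u j : `|u j 0| <= norm1 u.
Proof. by rewrite /norm1 (bigD1 j)//= lerDl sumr_ge0. Qed.

Lemma norm1_le_max u (K : R) :
  (forall j, `|u j 0| <= K) -> norm1 u <= d%:R * K.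
Proof.
move=> uK; apply: (@le_trans _ _ (\sum_(j < d) K)); first exact: ler_sum.
by rewrite sumr_const card_ord mulr_natl.
Qed.

Lemma dot_le_norm1 u v (K : R) :
  (forall j, `|v j 0| <= K) -> `|dot u v| <= norm1 u * K.
Proof.
move=> vK; rewrite dotE mulr_suml; apply: le_trans (ler_norm_sum _ _ _) _.
by apply: ler_sum => j _; rewrite normrM ler_wpM2l.
Qed.

Lemma dotC u v : dot u v = dot v u.
Proof. by rewrite !dotE; apply: eq_bigr => j _; rewrite mulrC. Qed.

Lemma cube_dot_le u (x : 'cV[R]_d) : cube x -> `|dot u x| <= norm1 u.
Proof.
move=> cx; rewrite -[norm1 u]mulr1; apply: dot_le_norm1 => j.
by have /andP[x0 x1] := cx j; rewrite ger0_norm.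
Qed.

End norm1.

Section sigma2_bounds.
Context {R : realType}.
Implicit Types y z : R.

Lemma sigma2_ge0 z : 0 <= sigma2 z.
Proof. by rewrite /sigma2 le_max lexx orbT. Qed.

Lemma sigma2_le_norm z : sigma2 z <= `|z|.
Proof. by rewrite /sigma2 ge_max ler_norm normr_ge0. Qed.

Lemma sigma2_lipschitz y z : `|sigma2 y - sigma2 z| <= `|y - z|.
Proof.
have n1 := ler_norm (y - z); have n2 := ler_norm (- (y - z)).
rewrite normrN in n2; move: (`|y - z|) n1 n2 => e n1 n2; rewrite !sigma2E.
by rewrite ler_norml; case: (leP 0 y) => ?; case: (leP 0 z) => ?; apply/andP; split; lra.
Qed.

Lemma heaviside_le1 z : `|heaviside z| <= 1.
Proof. by rewrite /heaviside; case: ifP => _; rewrite ?normr1 ?normr0. Qed.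

End sigma2_bounds.

Section neuron_bounds.
Context {R : realType} {d : nat}.
Variables (A : 'cV[R]_d -> 'M[R]_d) (b : 'cV[R]_d -> 'cV[R]_d)
  (c : 'cV[R]_d -> R) (M : R) (x : 'cV[R]_d).
Hypotheses (Abc : bounded_coefficients A b c M) (cx : cube x).
Implicit Types u v w : 'cV[R]_d.

Let A_le i j : `|A x i j| <= M. Proof. by have [_ + _ _] := Abc _ cx; exact. Qed.
Let b_le i : `|b x i 0| <= M. Proof. by have [_ _ + _] := Abc _ cx; exact. Qed.
Let c_le : `|c x| <= M. Proof. by have [] := Abc _ cx. Qed.
Let M0 : 0 <= M. Proof. exact: le_trans c_le. Qed.

Lemma aform_le u v : `|aform A x u v| <= M * norm1 u * norm1 v.
Proof.
rewrite -aformE (mulrC M) -mulrA; apply: dot_le_norm1 => i.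
rewrite mxE mulr_sumr; apply: le_trans (ler_norm_sum _ _ _) _.
by apply: ler_sum => j _; apply: ler_normM.
Qed.

Lemma aformB u v : aform A x u u - aform A x v v
  = aform A x (u - v) u + aform A x v (u - v).
Proof.
rewrite /aform -sumrB -big_split/=; apply: eq_bigr => i _.
rewrite -sumrB -big_split/=; apply: eq_bigr => j _.
by rewrite !mxE; ring.
Qed.

Let s w := sigma2 (dot w x).

Let s_le w : `|s w| <= norm1 w.
Proof.
rewrite ger0_norm ?sigma2_ge0//; apply: le_trans (sigma2_le_norm _) _.
exact: cube_dot_le.
Qed.

Let l_le w : `|dot (b x) w| <= M * norm1 w.
Proof. by rewrite dotC mulrC; exact: dot_le_norm1. Qed.

(** The constant is 1 + 1/2 + 1/6, one term for each order of the operator. *)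
Lemma neuron_le w : `|neuron A b c w x| <= 5 / 3 * M * norm1 w ^+ 3.
Proof.
rewrite neuronE -/(s w); have r0 := norm1_ge0 w; set r := norm1 w in r0 *.
have H1 : `|aform A x w w * s w| <= M * r * r * r by apply: ler_normM => //; exact: aform_le.
have s2 : `|s w ^+ 2| <= r ^+ 2 by rewrite !expr2; exact: ler_normM.
have H2 : `|dot (b x) w * (s w ^+ 2 / 2)| <= M * r * (r ^+ 2 * 2^-1).
  by apply: ler_normM => //; apply: ler_normM => //; rewrite ger0_norm.
have H3 : `|c x * (s w ^+ 3 / 6)| <= M * (r * r ^+ 2 * 6^-1).
  apply: ler_normM => //; apply: ler_normM; last by rewrite ger0_norm.
  by rewrite exprS; exact: ler_normM.
apply: le_trans (ler_normD _ _) _; apply: le_trans (lerD (ler_normD _ _) (lexx _)) _.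
apply: le_trans (lerD (lerD H1 H2) H3) _.
by rewrite le_eqVlt; apply/orP; left; apply/eqP; field.
Qed.

(** The product rule gives 2 + 1 for the second-order term, 1/2 + 1 for the first-order term and 1/2
    for the last. *)
Lemma dneuron_le w v :
  `|dneuron A b c x w v| <= 5 * M * norm1 w ^+ 2 * norm1 v.
Proof.
rewrite /dneuron -/(s w); have r0 := norm1_ge0 w; set r := norm1 w in r0 *.
set e := norm1 v; set s' := heaviside _ * _.
have s'e : `|s'| <= e.
  by rewrite -[e]mul1r; apply: ler_normM; [exact: heaviside_le1|exact: cube_dot_le].
have sr : `|s w| <= r by exact: s_le.
have s2 : `|s w ^+ 2 / 2| <= r ^+ 2 * 2^-1.
  by apply: ler_normM; [rewrite !expr2; exact: ler_normM|rewrite ger0_norm].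
have H1 : `|(aform A x v w + aform A x w v) * s w| <= (M * e * r + M * r * e) * r.
  apply: ler_normM => //; apply: le_trans (ler_normD _ _) _.
  by rewrite lerD ?aform_le.
have H2 : `|aform A x w w * s'| <= M * r * r * e.
  by apply: ler_normM => //; exact: aform_le.
have H3 : `|dot (b x) v * (s w ^+ 2 / 2)| <= M * e * (r ^+ 2 * 2^-1).
  by apply: ler_normM => //; exact: l_le.
have H4 : `|dot (b x) w * (s w * s')| <= M * r * (r * e).
  by apply: ler_normM; [exact: l_le|exact: ler_normM].
have H5 : `|c x * (s w ^+ 2 / 2 * s')| <= M * (r ^+ 2 * 2^-1 * e).
  by apply: ler_normM => //; exact: ler_normM.
do 4 (apply: le_trans (ler_normD _ _) _; rewrite -?lerBrDr).
move: H1 H2 H3 H4 H5; rewrite !lerBrDr.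
set a1 := `|_|; set a2 := `|_|; set a3 := `|_|; set a4 := `|_|; set a5 := `|_|.
move=> H1 H2 H3 H4 H5; apply: le_trans (lerD (lerD (lerD (lerD H1 H2) H3) H4) H5) _.
by rewrite le_eqVlt; apply/orP; left; apply/eqP; field.
Qed.

(** The differences are telescoped by hand, giving the constant of [dneuron_le] again: a segment
    from [w] to [u] may cross the kink, so [dneuron] is not integrated along it. *)
Lemma neuron_lipschitz u w (r : R) : norm1 u <= r -> norm1 w <= r ->
  `|neuron A b c u x - neuron A b c w x| <= 5 * M * r ^+ 2 * norm1 (u - w).
Proof.
move=> ur wr; have r0 := le_trans (norm1_ge0 u) ur; set e := norm1 (u - w).
have e0 : 0 <= e by exact: norm1_ge0.
rewrite !neuronE -/(s u) -/(s w).
have su : `|s u| <= r by exact: le_trans (s_le u) ur.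
have sw : `|s w| <= r by exact: le_trans (s_le w) wr.
have sB : `|s u - s w| <= e.
  by apply: le_trans (sigma2_lipschitz _ _) _; rewrite -dotBl; exact: cube_dot_le.
have qB : `|aform A x u u - aform A x w w| <= M * e * r + M * r * e.
  rewrite aformB; apply: le_trans (ler_normD _ _) _; rewrite lerD//.
    by apply: le_trans (aform_le _ _) _; rewrite ler_wpM2l// mulr_ge0.
  apply: le_trans (aform_le _ _) _; rewrite -/e ler_wpM2r//.
  by rewrite ler_wpM2l.
have lB : `|dot (b x) u - dot (b x) w| <= M * e.
  by rewrite ![dot (b x) _]dotC -dotBl dotC; exact: l_le.
have qw : `|aform A x w w| <= M * r * r.
  apply: le_trans (aform_le _ _) _.
  by rewrite ler_pM// ?ler_wpM2l// ?mulr_ge0// norm1_ge0.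
have lw : `|dot (b x) w| <= M * r.
  by apply: le_trans (l_le _) _; rewrite ler_wpM2l.
pose q v := aform A x v v; pose l v := dot (b x) v.
have -> : q u * s u + l u * (s u ^+ 2 / 2) + c x * (s u ^+ 3 / 6)
    - (q w * s w + l w * (s w ^+ 2 / 2) + c x * (s w ^+ 3 / 6)) =
    ((q u - q w) * s u + q w * (s u - s w))
    + ((l u - l w) * (s u * s u) / 2 + l w * ((s u - s w) * (s u + s w)) / 2)
    + c x * ((s u - s w) * (s u * s u + s u * s w + s w * s w)) / 6.
  by field.
have h2 : `|2^-1 : R| <= 2^-1 by rewrite ger0_norm.
have h6 : `|6^-1 : R| <= 6^-1 by rewrite ger0_norm.
have s3 : `|s u * s u + s u * s w + s w * s w| <= r * r + r * r + r * r.
  apply: le_trans (ler_normD _ _) _; apply: lerD; last exact: ler_normM.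
  by apply: le_trans (ler_normD _ _) _; apply: lerD; exact: ler_normM.
have sD : `|s u + s w| <= r + r by apply: le_trans (ler_normD _ _) _; exact: lerD.
have H1 := ler_normM _ _ _ _ _ qB su.
have H2 := ler_normM _ _ _ _ _ qw sB.
have H3 := ler_normM _ _ _ _ _ (ler_normM _ _ _ _ _ lB (ler_normM _ _ _ _ _ su su)) h2.
have H4 := ler_normM _ _ _ _ _ (ler_normM _ _ _ _ _ lw (ler_normM _ _ _ _ _ sB sD)) h2.
have H5 := ler_normM _ _ _ _ _ (ler_normM _ _ _ _ _ c_le (ler_normM _ _ _ _ _ sB s3)) h6.
apply: le_trans (ler_normD _ _) _; apply: le_trans (lerD (ler_normD _ _) (lexx _)) _.
apply: le_trans (lerD (lerD (ler_normD _ _) (ler_normD _ _)) (lexx _)) _.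
apply: le_trans (lerD (lerD (lerD H1 H2) (lerD H3 H4)) H5) _.
by rewrite le_eqVlt; apply/orP; left; apply/eqP; field.
Qed.

End neuron_bounds.

Section neuron_regularity.
Context {R : realType} {d : nat}.
Variables (A : 'cV[R]_d -> 'M[R]_d) (b : 'cV[R]_d -> 'cV[R]_d)
  (c : 'cV[R]_d -> R) (x : 'cV[R]_d).
Implicit Types u v w : 'cV[R]_d.

Lemma gauged_neuron (T B : R) (G : R -> R -> R) (w : R -> 'cV[R]_d) :
  (forall s t, 0 <= s -> s <= t -> t <= T -> 0 <= G s t <= B) ->
  (forall j, gauged T G (fun t => w t j 0)) ->
  gauged T G (fun t => neuron A b c (w t) x).
Proof.
move=> GB gw; have gM h1 h2 := @gaugedM R T B G GB h1 h2; under eq_fun do rewrite neuronE.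
have gdot (y : 'cV[R]_d) : gauged T G (fun t => dot y (w t)).
  under eq_fun do rewrite dotE; apply: gauged_sum => // j.
  by apply: (gM _ _) => //; exact: gauged_cst.
have gs : gauged T G (fun t => sigma2 (dot (w t) x)).
  by apply: gauged_sigma2; under eq_fun do rewrite dotC; exact: gdot.
have gs2 : gauged T G (fun t => sigma2 (dot (w t) x) ^+ 2).
  by under eq_fun do rewrite expr2; exact: gM.
apply: gaugedD => //; first apply: gaugedD => //.
- apply: (gM _ _) => //; apply: gauged_sum => // i; apply: gauged_sum => // j.
  by apply: (gM _ _) => //; apply: (gM _ _) => //; exact: gauged_cst.
- by apply: (gM _ _) => //; apply: (gM _ _) => //; exact: gauged_cst.
- apply: (gM _ _) => //; first exact: gauged_cst.
  apply: (gM _ _) => //; last exact: gauged_cst.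
  by under eq_fun do rewrite exprS; exact: gM.
Qed.

Lemma sigma2_continuous : continuous (@sigma2 R).
Proof.
move=> z; apply/cvgrPdist_le => e e0; near=> y.
apply: le_trans (sigma2_lipschitz _ _) _.
by near: y; exact: cvgr_dist_le.
Unshelve. all: by end_near. Qed.

Section cvg_neuron.
Variables (u : nat -> 'cV[R]_d) (w : 'cV[R]_d).
Hypothesis uw : forall j, u n j 0 @[n --> \oo] --> w j 0.

Let cvg_osum (I : finType) (f : I -> nat -> R) (l : I -> R) :
  (forall i, f i n @[n --> \oo] --> l i) ->
  \sum_i f i n @[n --> \oo] --> \sum_i l i.
Proof. by move=> fl; apply: cvg_big => //; exact: add_continuous. Qed.

Let cvg_dot (y : 'cV[R]_d) : dot y (u n) @[n --> \oo] --> dot y w.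
Proof.
under eq_cvg do rewrite dotE; rewrite dotE.
by apply: cvg_osum => j; apply: cvgM; [exact: cvg_cst|exact: uw].
Qed.

Let cvg_s : sigma2 (dot (u n) x) @[n --> \oo] --> sigma2 (dot w x).
Proof.
apply: continuous_cvg; first exact: sigma2_continuous.
by rewrite dotC; under eq_cvg do rewrite dotC; exact: cvg_dot.
Qed.

Let cvg_aform : aform A x (u n) (u n) @[n --> \oo] --> aform A x w w.
Proof.
apply: cvg_osum => i; apply: cvg_osum => j.
by apply: cvgM; [apply: cvgM; [exact: uw|exact: cvg_cst]|exact: uw].
Qed.

Lemma cvg_neuron : neuron A b c (u n) x @[n --> \oo] --> neuron A b c w x.
Proof.
under eq_cvg do rewrite neuronE; rewrite neuronE.
apply: cvgD; first apply: cvgD; apply: cvgM => //.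
- apply: cvgM; last exact: cvg_cst.
  by under eq_cvg do rewrite expr2; rewrite expr2; exact: cvgM.
- exact: cvg_cst.
- apply: cvgM; last exact: cvg_cst.
  under eq_cvg do rewrite !exprS expr0; rewrite !exprS expr0.
  by do 2 (apply: cvgM => //); apply: cvgM => //; exact: cvg_cst.
Qed.

(** Regularity of a fixed [v] is open in [w]: off the kink [dot w x] stays nonzero nearby, and at
    the kink [dot v x] = 0 makes [v] regular at every point. *)
Lemma near_regular v : regular x w v -> \forall n \near \oo, regular x (u n) v.
Proof.
move=> reg; have [/reg vx|wx] := eqVneq (dot w x) 0; first by near=> n => _.
have : \forall n \near \oo, dot (u n) x != 0.
  apply: cvgr_neq0 wx; rewrite dotC.
  by under eq_cvg do rewrite dotC; exact: cvg_dot.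
by apply: filterS => n /eqP un0 /un0.
Unshelve. all: by end_near. Qed.

(** The only discontinuous factor is [heaviside]. It is locally constant off the kink, and at the
    kink it is multiplied by 0. *)
Lemma cvg_dneuron v : regular x w v ->
  dneuron A b c x (u n) v @[n --> \oo] --> dneuron A b c x w v.
Proof.
move=> reg.
have cs' : heaviside (dot (u n) x) * dot v x @[n --> \oo] -->
    heaviside (dot w x) * dot v x.
  have [/reg ->|wx] := eqVneq (dot w x) 0.
    by rewrite mulr0; under eq_cvg do rewrite mulr0; exact: cvg_cst.
  apply: cvg_near_cst; have cz : dot (u n) x @[n --> \oo] --> dot w x.
    by rewrite dotC; under eq_cvg do rewrite dotC; exact: cvg_dot.
  move: wx; rewrite neq_lt => /orP[w0|w0].
    near=> n; rewrite /heaviside !ltNge (ltW w0)/=.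
    by rewrite ifF//; apply/negbTE; rewrite negbK ltW//; near: n; exact: (cvgr_lt (dot w x)).
  near=> n; rewrite /heaviside w0 ifT//.
  by near: n; exact: (cvgr_gt (dot w x)).
have cq1 : aform A x v (u n) @[n --> \oo] --> aform A x v w.
  apply: cvg_osum => i; apply: cvg_osum => j.
  by apply: cvgM; [exact: cvg_cst|exact: uw].
have cq2 : aform A x (u n) v @[n --> \oo] --> aform A x w v.
  apply: cvg_osum => i; apply: cvg_osum => j.
  by apply: cvgM; [apply: cvgM; [exact: uw|exact: cvg_cst]|exact: cvg_cst].
have cs2 : sigma2 (dot (u n) x) ^+ 2 / 2 @[n --> \oo] --> sigma2 (dot w x) ^+ 2 / 2.
  by apply: cvgM; [under eq_cvg do rewrite expr2; rewrite expr2; exact: cvgM|exact: cvg_cst].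
rewrite /dneuron/=.
apply: cvgD; last by apply: cvgM; [exact: cvg_cst|exact: cvgM].
apply: cvgD; last by apply: cvgM; [exact: cvg_dot|exact: cvgM].
apply: cvgD; last by apply: cvgM; [exact: cvg_cst|exact: cs2].
apply: cvgD; first by apply: cvgM; [exact: cvgD|exact: cvg_s].
by apply: cvgM; [exact: cvg_aform|exact: cs'].
Unshelve. all: by end_near. Qed.

End cvg_neuron.
End neuron_regularity.

(** * Clarke gradients *)

Section clarke.
Context {R : realType} {p q : nat}.
Implicit Types (F : 'M[R]_(p, q) -> R) (theta g v : 'M[R]_(p, q)).

Definition mxdot g v : R := \sum_i \sum_j g i j * v i j.

Lemma grad_mxdot F theta v : differentiable F theta ->
  mxdot (grad F theta) v = 'D_v F theta.
Proof.
move=> dF; rewrite deriveE// {2}(matrix_sum_delta v) linear_sum/=.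
apply: eq_bigr => i _; rewrite linear_sum/=; apply: eq_bigr => j _.
by rewrite linearZ/= mxE deriveE// mulrC.
Qed.

Lemma mxdotDl g1 g2 v : mxdot (g1 + g2) v = mxdot g1 v + mxdot g2 v.
Proof.
rewrite -big_split/=; apply: eq_bigr => i _; rewrite -big_split/=.
by apply: eq_bigr => j _; rewrite mxE mulrDl.
Qed.

Lemma mxdotZl a g v : mxdot (a *: g) v = a * mxdot g v.
Proof.
rewrite mulr_sumr; apply: eq_bigr => i _; rewrite mulr_sumr.
by apply: eq_bigr => j _; rewrite mxE mulrA.
Qed.

(** The matrices whose pairing with [v] equals [l] form an affine, hence convex, set, so only
    limiting gradients have to be checked. *)
Lemma clarke_mxdot F theta g v l : clarke_gradient F theta g ->
  (forall u : nat -> 'M[R]_(p, q), u @ \oo --> theta ->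
    (forall k, differentiable F (u k)) -> 'D_v F (u k) @[k --> \oo] --> l) ->
  mxdot g v = l.
Proof.
move=> + Fl; have : clarke_gradient F theta `<=` [set g | mxdot g v = l].
  apply: smallest_sub.
    move=> g1 g2 lam; rewrite !inE/= => g1l g2l.
    rewrite /conv/= mxdotDl !mxdotZl g1l g2l -mulrDl.
    by rewrite /unstable.onem addrC subrK mul1r.
  move=> h [u [utheta dF ug]] /=.
  have := Fl u utheta dF; under eq_cvg do rewrite -grad_mxdot//.
  move=> H; apply: (cvg_unique _ _ H) => //.
  apply: cvg_big => [|i _]; first exact: add_continuous.
  apply: cvg_big => [|j _]; first exact: add_continuous.
  apply: cvgM; last exact: cvg_cst.
  have /continuous_cvg/(_ ug) := @coord_continuous R p q i j h.
  exact.
by move=> H /H.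
Qed.

End clarke.

(** * Directional derivatives of the empirical risk *)

Section risk.
Context {R : realType} {d m n : nat}.
Variables (A : 'cV[R]_d -> 'M[R]_d) (b : 'cV[R]_d -> 'cV[R]_d)
  (c f : 'cV[R]_d -> R) (X : 'I_n -> 'cV[R]_d).
Implicit Types theta v g : 'M[R]_(m, 1 + d).

Let RS : 'M[R]_(m, 1 + d) -> R := emp_risk A b c f X.

Lemma outerE theta k : outer theta k = theta k (lshift d 0).
Proof. by rewrite /outer mxE. Qed.

Lemma innerE theta k j : inner theta k j 0 = theta k (rshift 1 j).
Proof. by rewrite /inner !mxE. Qed.

Definition residual theta i := pde_net A b c theta (X i) - f (X i).

Definition neuron_diff theta v k i :=
  outer v k * neuron A b c (inner theta k) (X i)
  + outer theta k * dneuron A b c (X i) (inner theta k) (inner v k).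

(* The directional derivative of the risk, when v is a regular direction. *)
Definition risk_diff theta v : R :=
  n%:R^-1 * \sum_i residual theta i * \sum_k neuron_diff theta v k i.

Definition regular_dir theta v :=
  forall k i, regular (X i) (inner theta k) (inner v k).

Lemma riskE theta : RS theta = (2 * n%:R)^-1 * \sum_i residual theta i ^+ 2.
Proof. by []. Qed.

Lemma is_derive_risk (th : R -> 'M[R]_(m, 1 + d)) v (t : R) :
  (forall k j, is_derive t 1 (fun s => th s k j) (v k j)) ->
  regular_dir (th t) v ->
  is_derive t 1 (fun s => RS (th s)) (risk_diff (th t) v).
Proof.
move=> dth reg.
have dres i : is_derive t 1 (fun s => residual (th s) i)
    (\sum_k neuron_diff (th t) v k i).
  have -> : (fun s => residual (th s) i) =
      (fun s => \sum_k outer (th s) k * neuron A b c (inner (th s) k) (X i))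
      - cst (f (X i)).
    by apply/funext => s; rewrite /residual pde_netE.
  rewrite -[X in is_derive _ _ _ X]subr0; apply: is_deriveB.
  apply: is_derive_bigsum => k.
  have dN : is_derive t 1 (fun s => neuron A b c (inner (th s) k) (X i))
      (dneuron A b c (X i) (inner (th t) k) (inner v k)).
    apply: (@is_derive_neuron _ _ _ _ _ _ (fun s => inner (th s) k)); last exact: reg.
    by move=> j; under eq_fun do rewrite innerE; rewrite innerE.
  have dO : is_derive t 1 (fun s => outer (th s) k) (outer v k).
    by under eq_fun do rewrite outerE; rewrite outerE.
  apply: (is_derive_eq (is_deriveM dO dN)).
  by rewrite /neuron_diff /GRing.scale/= addrC mulrC [X in X + _]mulrC mulrC.
have -> : (fun s => RS (th s)) = (2 * n%:R)^-1 \*: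
    (fun s => \sum_i residual (th s) i ^+ 2) by [].
have dsum : is_derive t 1 (fun s => \sum_i residual (th s) i ^+ 2)
    (\sum_i 2 * (residual (th t) i * \sum_k neuron_diff (th t) v k i)).
  apply: is_derive_bigsum => i.
  have -> : (fun s => residual (th s) i ^+ 2) =
    (fun s => residual (th s) i) * (fun s => residual (th s) i).
    by apply/funext => s; rewrite expr2.
  apply: (is_derive_eq (is_deriveM (dres i) (dres i))).
  by rewrite -mulr2n mulr_natl.
apply: (is_derive_eq (is_deriveZ _ dsum)).
rewrite /risk_diff -mulr_sumr /GRing.scale/= invfM mulrA; congr (_ * _).
by rewrite mulrAC mulVf ?mul1r// pnatr_eq0.
Qed.

Lemma derive_risk theta v : regular_dir theta v -> 'D_v RS theta = risk_diff theta v.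
Proof.
move=> reg; pose th (s : R) := s *: v + theta.
have th0 : th 0 = theta by rewrite /th scale0r add0r.
have := @is_derive_risk th v 0; rewrite th0 => /(_ _ reg)[].
  move=> k j; rewrite (_ : (fun s => _) = (v k j) \*: id + cst (theta k j)).
    by apply: is_derive_eq; rewrite addr0 [_%:A]mulr1.
  by apply/funext => s; rewrite /th !mxE mulrC.
move=> _ <-; rewrite /derive; congr (lim (_ @ 0^')).
by apply/funext => h /=; rewrite addr0 th0 [h *: 1]mulr1.
Qed.

(** A direction regular at [theta] is regular at all nearby points, and [risk_diff] is continuous
    there. Hence all sequences defining limiting gradients see the same limit in this direction. *)
Lemma clarke_risk theta g v : clarke_gradient RS theta g ->
  regular_dir theta v -> mxdot g v = risk_diff theta v.
Proof.
move=> cg reg; apply: (clarke_mxdot _ _ _ _ _ cg) => u utheta du.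
have ucoord k j : u s k j @[s --> \oo] --> theta k j.
  by have /continuous_cvg/(_ utheta) := @coord_continuous R m (1 + d) k j theta; exact.
have uinner k j : inner (u s) k j 0 @[s --> \oo] --> inner theta k j 0.
  by under eq_cvg do rewrite innerE; rewrite innerE; exact: ucoord.
have uouter k : outer (u s) k @[s --> \oo] --> outer theta k.
  by under eq_cvg do rewrite outerE; rewrite outerE; exact: ucoord.
have near_reg : \forall s \near \oo, regular_dir (u s) v.
  apply: filter_forall => k; apply: filter_forall => i.
  by apply: near_regular; [move=> j; exact: uinner|exact: reg].
have : risk_diff (u s) v @[s --> \oo] --> risk_diff theta v.
  have cN k i : neuron A b c (inner (u s) k) (X i) @[s --> \oo] -->
      neuron A b c (inner theta k) (X i) by apply: cvg_neuron => j; exact: uinner.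
  apply: cvgM; first exact: cvg_cst.
  apply: cvg_big => [|i _]; first exact: add_continuous.
  apply: cvgM.
    apply: cvgB; last exact: cvg_cst.
    under eq_cvg do rewrite pde_netE; rewrite pde_netE.
    apply: cvg_big => [|k _]; first exact: add_continuous.
    by apply: cvgM; [exact: uouter|exact: cN].
  apply: cvg_big => [|k _]; first exact: add_continuous.
  apply: cvgD; first by apply: cvgM; [exact: cvg_cst|exact: cN].
  apply: cvgM; first exact: uouter.
  by apply: cvg_dneuron; [move=> j; exact: uinner|exact: reg].
apply: cvg_trans; apply: near_eq_cvg; apply: filterS near_reg => s.
by move=> /derive_risk.
Qed.

End risk.

Section dot0.
Context {R : realType} {d : nat}.
Implicit Types u : 'cV[R]_d.

Lemma dot0 u : dot u 0 = 0.
Proof. by rewrite /dot mulmx0 mxE. Qed.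

Lemma dot0l u : dot 0 u = 0.
Proof. by rewrite dotC dot0. Qed.

Lemma dneuron0 A b c (x w : 'cV[R]_d) : dneuron A b c x w 0 = 0.
Proof. by rewrite /dneuron -!aformE !mulmx0 !dot0 !dot0l/= !(mulr0, mul0r, addr0). Qed.

End dot0.

(** * Components of the flow velocity *)

Section flow_direction.
Context {R : realType} {d m n : nat}.
Variables (A : 'cV[R]_d -> 'M[R]_d) (b : 'cV[R]_d -> 'cV[R]_d)
  (c f : 'cV[R]_d -> R) (M : R) (X : 'I_n -> 'cV[R]_d).
Hypotheses (M0 : 0 <= M) (Abc : bounded_coefficients A b c M)
  (cX : forall i, cube (X i)).
Implicit Types theta v g h : 'M[R]_(m, 1 + d).

Let RS : 'M[R]_(m, 1 + d) -> R := emp_risk A b c f X.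
Let e := @residual R d m n A b c f X.
Local Notation N theta k i := (neuron A b c (inner theta k) (X i)).

Lemma mxdot_blocks g h : mxdot g h =
  \sum_k (outer g k * outer h k + dot (inner g k) (inner h k)).
Proof.
apply: eq_bigr => k _; rewrite big_split_ord/= big_ord1 !outerE dotE.
by congr (_ + _); apply: eq_bigr => j _; rewrite !innerE.
Qed.

Lemma dot_ge0 (u : 'cV[R]_d) : 0 <= dot u u.
Proof. by rewrite dotE sumr_ge0// => j _; rewrite -expr2 sqr_ge0. Qed.

(** Cauchy-Schwarz against the constant 1, read off from the sum of all (g i - g j)^2. *)
Lemma sqr_sum_le (I : finType) (g : I -> R) :
  (\sum_i g i) ^+ 2 <= #|I|%:R * \sum_i g i ^+ 2.
Proof.
have : 0 <= \sum_(i : I) \sum_(j : I) (g i - g j) ^+ 2.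
  by apply: sumr_ge0 => i _; apply: sumr_ge0 => j _; exact: sqr_ge0.
have -> : \sum_(i : I) \sum_(j : I) (g i - g j) ^+ 2 =
    \sum_(i : I) \sum_(j : I) g i ^+ 2 + \sum_(i : I) \sum_(j : I) g j ^+ 2
    - 2 * \sum_(i : I) \sum_(j : I) g i * g j.
  rewrite mulr_sumr -big_split/= -sumrB; apply: eq_bigr => i _.
  rewrite mulr_sumr -big_split/= -sumrB; apply: eq_bigr => j _; ring.
have -> : \sum_(i : I) \sum_(j : I) g i ^+ 2 = #|I|%:R * \sum_i g i ^+ 2.
  by under eq_bigr do rewrite sumr_const; rewrite sumrMnl mulr_natl.
have -> : \sum_(i : I) \sum_(j : I) g j ^+ 2 = #|I|%:R * \sum_i g i ^+ 2.
  by rewrite sumr_const mulr_natl.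
have -> : \sum_(i : I) \sum_(j : I) g i * g j = (\sum_i g i) ^+ 2.
  by rewrite expr2 big_distrlr.
lra.
Qed.

Lemma mean_residual_le theta : n%:R^-1 * \sum_i `|e theta i| <= Num.sqrt (2 * RS theta).
Proof.
have [n0|n0] := posnP n.
  rewrite big1 ?mulr0 ?sqrtr_ge0// => i _.
  by have := ltn_ord i; rewrite {2}n0.
have nR : 0 < n%:R :> R by rewrite ltr0n.
rewrite -[leLHS]ger0_norm; last by rewrite mulr_ge0 ?invr_ge0// sumr_ge0.
rewrite -sqrtr_sqr ler_wsqrtr// /RS riskE -/e invfM mulrA mulrA mulfV// mul1r exprMn.
apply: le_trans (ler_wpM2l _ (sqr_sum_le _ _)) _; first exact: sqr_ge0.
rewrite card_ord mulrA expr2 -(mulrA n%:R^-1) mulVf ?gt_eqF// mulr1.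
rewrite ler_wpM2l ?invr_ge0//.
by apply: ler_sum => i _; rewrite real_normK ?num_real.
Qed.

Section direction.
Variables theta v : 'M[R]_(m, 1 + d).
Hypotheses (cg : clarke_gradient RS theta (- v)) (reg : regular_dir X theta v).

Let dirE h : regular_dir X theta h -> - mxdot v h = risk_diff A b c f X theta h.
Proof.
by move=> rh; rewrite -(clarke_risk _ _ _ _ _ _ _ _ cg rh) -[in RHS]scaleN1r mxdotZl mulN1r.
Qed.

(** The energy identity: [v], being regular, may be paired with the Clarke gradient [- v] itself. *)
Lemma flow_risk_diff : risk_diff A b c f X theta v = - mxdot v v.
Proof. by rewrite dirE. Qed.

(** The test direction moves a_k alone. It leaves every product w . x fixed, hence is always
    regular. *)
Lemma flow_outer k : outer v k = - (n%:R^-1 * \sum_i e theta i * N theta k i).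
Proof.
pose h := param (fun k' => (k' == k)%:R) (fun=> 0) : 'M[R]_(m, 1 + d).
have /dirE : regular_dir X theta h.
  by move=> k' i _; rewrite inner_param dot0l.
rewrite mxdot_blocks (bigD1 k)//= outer_param inner_param dot0 eqxx mulr1 addr0.
rewrite big1 => [|k' kk']; last first.
  by rewrite outer_param inner_param dot0 (negbTE kk') mulr0 addr0.
rewrite addr0 => vk; rewrite -[LHS]opprK vk; congr (- (_ * _)).
apply: eq_bigr => i _; congr (_ * _); rewrite (bigD1 k)//= big1 => [|k' kk'].
  rewrite addr0 /neuron_diff outer_param inner_param eqxx mul1r.
  by rewrite dneuron0 mulr0 addr0.
rewrite /neuron_diff outer_param inner_param (negbTE kk') mul0r add0r.
by rewrite dneuron0 mulr0.
Qed.

(** The test direction is the w_k-block of [v] itself, which inherits the regularity of [v]. It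
    yields a bound on the squared Euclidean norm of this block, linear in its 1-norm. *)
Lemma flow_inner_le k : norm1 (inner v k) <= d%:R *
  (Num.sqrt (2 * RS theta) * (`|outer theta k| * (5 * M * norm1 (inner theta k) ^+ 2))).
Proof.
pose h := param (fun=> 0) (fun k' => if k' == k then inner v k else 0) : 'M[R]_(m, 1 + d).
have /dirE : regular_dir X theta h.
  move=> k' i; rewrite /regular inner_param; case: eqP => [->|_] z0; last by rewrite dot0l.
  exact: reg.
rewrite mxdot_blocks (bigD1 k)//= outer_param inner_param mulr0 add0r eqxx.
rewrite big1 => [|k' kk']; last first.
  by rewrite outer_param inner_param (negbTE kk') dot0 mulr0 addr0.
rewrite addr0 => vk.
set s := Num.sqrt _; set L := `|outer theta k| * _; set r := norm1 (inner v k).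
have L0 : 0 <= L by rewrite !mulr_ge0// norm1_ge0.
have r0 : 0 <= r by exact: norm1_ge0.
have vv_le : dot (inner v k) (inner v k) <= s * (L * r).
  rewrite -[leLHS]opprK vk; apply: le_trans (ler_norm _) _.
  rewrite normrN /risk_diff normrM ger0_norm ?invr_ge0//.
  apply: le_trans (ler_wpM2r (mulr_ge0 L0 r0) (mean_residual_le theta)).
  rewrite -mulrA ler_wpM2l ?invr_ge0// mulr_suml.
  apply: le_trans (ler_norm_sum _ _ _) _; apply: ler_sum => i _.
  rewrite normrM ler_wpM2l//= (bigD1 k)//= big1 => [|k' kk'].
    rewrite addr0 /neuron_diff outer_param inner_param eqxx mul0r add0r normrM.
    by rewrite -mulrA ler_wpM2l// dneuron_le.
  rewrite /neuron_diff outer_param inner_param (negbTE kk') mul0r add0r.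
  by rewrite dneuron0 mulr0.
(* Comparing the squared 1-norm with the squared Euclidean norm costs the factor d; one factor [r]
   then cancels. *)
have : r ^+ 2 <= d%:R * (s * (L * r)).
  apply: le_trans (sqr_sum_le _ _) _; rewrite card_ord ler_wpM2l//.
  apply: le_trans vv_le; rewrite dotE; apply: ler_sum => j _.
  by rewrite real_normK ?num_real// expr2.
have := r0; rewrite le_eqVlt => /predU1P[<- _|rpos].
  by rewrite mulr_ge0// mulr_ge0 //; exact: sqrtr_ge0.
by rewrite expr2 !mulrA ler_pM2r// -!mulrA.
Qed.

(** Only the outer weights are kept; the inner ones contribute a nonnegative square. *)
Lemma flow_dissipation : mxdot v v >=
  (n%:R ^+ 2)^-1 * \sum_k (\sum_i e theta i * N theta k i) ^+ 2.
Proof.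
rewrite mxdot_blocks mulr_sumr; apply: ler_sum => k _.
rewrite flow_outer -expr2 sqrrN exprMn exprVn lerDl; exact: dot_ge0.
Qed.

End direction.
End flow_direction.

(** * Gradient flow *)

Section ae_derivatives.
Context {R : realType}.
Notation mu := (@lebesgue_measure R).

(** Lebesgue differentiation applied to [f] cut off outside [0, T], which changes neither the
    integral near a t < T nor the value at t. *)
Lemma ae_derive_integral (f : R -> R) (T : R) :
  mu.-integrable `[0, T] (EFin \o f) ->
  {ae mu, forall t, 0 < t < T ->
    is_derive t 1 (fun s : R => \int[mu]_(x in `[0, s]) f x) (f t)}.
Proof.
move=> intf; pose g := f \_ `[0, T].
have intg : mu.-integrable setT (EFin \o g).
  by rewrite -restrict_EFin; apply/integrable_restrict => //=; rewrite setTI.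
have intg0 (y : R) :
    mu.-integrable [set` Interval (BLeft 0) (BRight y)] (EFin \o g).
  exact: integrableS intg.
have := FTC1 intg0 (integrable_locally (measurable_itv _) intf).
apply: filterS; first exact: (ae_filter_ringOfSetsType mu).
move=> t H /andP[t0 tT]; have {H}[|dg gt] := H; first by rewrite lte_fin.
have fgt : g t = f t by rewrite /g patchE mem_set//= in_itv/= (ltW t0) ltW.
apply: (@near_eq_is_derive _ _ _ (fun s : R => \int[mu]_(x in `[0, s]) g x)).
  near=> s; apply: eq_Rintegral => x; rewrite inE/= in_itv/= => /andP[x0 xs].
  rewrite /g patchE mem_set//= in_itv/= x0/= (le_trans xs)// ltW//.
  near: s; exact: lt_nbhsl.
by rewrite -fgt -gt derive1E; apply: derivableP.
Unshelve. all: by end_near. Qed.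

(* A zero of h with a nonzero derivative is an isolated zero, and the isolated
   points of a set of reals are countably many. *)
Lemma ae_zero_derive (h : R -> R) :
  {ae mu, forall t : R, forall l, is_derive t 1 h l -> h t = 0 -> l = 0}.
Proof.
pose S := [set t | h t = 0].
have cS := @countable_isolated R S.
exists (isolated S); split.
- exact: countable_measurable.
- exact: countable_lebesgue_measure0.
move=> t /= /existsNP[l /not_implyP[dh /not_implyP[ht /eqP l0]]].
split; first by rewrite inE.
have [/cvg_ex[/= l' hl] E] := dh.
have l'l : l' = l by rewrite -E /derive; apply/esym/cvg_lim.
rewrite l'l in hl.
have : \forall e \near (0 : R)^', e^-1 *: (h (e *: 1 + t) - h t) != 0.
  exact: (cvgr_neq0 _ hl).
move=> [r /= r0 hr]; exists (ball t r); first exact: nbhsx_ballx.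
apply/seteqP; split => [y [ty yS]|y ->]; last first.
  by split => //; exact: ballxx.
apply/eqP/negPn/negP => yt.
have := hr (y - t); rewrite /ball/= sub0r normrN distrC => /(_ ty).
rewrite subr_eq0 => /(_ yt).
by rewrite [(y - t) *: 1]mulr1 subrK yS ht subrr scaler0 eqxx.
Qed.

End ae_derivatives.

Section flow.
Context {R : realType} {d m n : nat}.
Notation mu := (@lebesgue_measure R).
Variables (A : 'cV[R]_d -> 'M[R]_d) (b : 'cV[R]_d -> 'cV[R]_d)
  (c f : 'cV[R]_d -> R) (X : 'I_n -> 'cV[R]_d).

Let RS : 'M[R]_(m, 1 + d) -> R := emp_risk A b c f X.

Variables (theta0 : 'M[R]_(m, 1 + d)) (theta v : R -> 'M[R]_(m, 1 + d)).
Hypothesis intv : forall i j t, 0 <= t ->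
  mu.-integrable `[0, t] (fun s => (v s i j)%:E).
Hypothesis thetaE : forall i j t, 0 <= t ->
  theta t i j = theta0 i j + \int[mu]_(s in `[0, t]) v s i j.
Hypothesis clarke : {ae mu, forall s : R, 0 <= s ->
  clarke_gradient RS (theta s) (- v s)}.

Definition flow_time (t : R) := [/\
  forall k j, is_derive t 1 (fun s => theta s k j) (v t k j),
  regular_dir X (theta t) (v t) &
  clarke_gradient RS (theta t) (- v t)].

Lemma flow_theta0 : theta 0 = theta0.
Proof.
by apply/matrixP => i j; rewrite thetaE// set_itv1 Rintegral_set1 addr0.
Qed.

Lemma ae_flow_time T : {ae mu, forall t : R, 0 < t < T -> flow_time t}.
Proof.
have [T0|T0] := leP T 0.
  by apply: aeW => t /andP[t0 tT]; have := lt_trans t0 tT; rewrite ltNge T0.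
have H1 : {ae mu, forall t : R, forall k j, 0 < t < T ->
    is_derive t 1 (fun s : R => \int[mu]_(x in `[0, s]) v x k j) (v t k j)}.
  apply: filter_forall => k; apply: filter_forall => j.
  by apply: ae_derive_integral; apply: intv; exact: ltW.
have H2 : {ae mu, forall t : R, forall k i, forall l,
    is_derive t 1 (fun s => dot (inner (theta s) k) (X i)) l ->
    dot (inner (theta t) k) (X i) = 0 -> l = 0}.
  apply: filter_forall => k; apply: filter_forall => i.
  exact: ae_zero_derive.
move: H1 H2 clarke; apply: filterS3; first exact: (ae_filter_ringOfSetsType mu).
move=> t H1 H2 H3 /[dup] t0T /andP[t0 tT].
have dth k j : is_derive t 1 (fun s => theta s k j) (v t k j).
  have := H1 k j t0T => dI.
  apply: (@near_eq_is_derive _ _ _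
    (fun s : R => theta0 k j + \int[mu]_(x in `[0, s]) v x k j)).
    near=> s; rewrite -thetaE// ltW//; near: s; exact: lt_nbhsr.
  rewrite -[X in is_derive _ _ _ X]add0r; exact: is_deriveD.
split => //; last by apply: H3; exact: ltW.
move=> k i; apply: H2.
under eq_fun do rewrite dotE; rewrite dotE; apply: is_derive_bigsum => j.
have -> : (fun s => inner (theta s) k j 0 * X i j 0) =
    (X i j 0) \*: (fun s => theta s k (rshift 1 j)).
  by apply/funext => s; rewrite innerE mulrC.
by apply: is_derive_eq; rewrite innerE mulrC.
Unshelve. all: by end_near. Qed.

(** The summand 1 makes [travel] dominate elapsed time as well, so that t itself and the exponential
    weights are gauged. *)
Definition speed s := 1 + \sum_k \sum_j `|v s k j|.
Definition travel s t := \int[mu]_(x in `]s, t]) speed x.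

Lemma speed_ge1 s : 1 <= speed s.
Proof. by rewrite lerDl sumr_ge0// => k _; rewrite sumr_ge0. Qed.

Lemma coord_le_speed s k j : `|v s k j| <= speed s.
Proof.
have vk : `|v s k j| <= \sum_j `|v s k j|.
  by rewrite [leRHS](bigD1 j)//= lerDl sumr_ge0.
apply: le_trans vk _; rewrite /speed (bigD1 k)//= addrCA lerDl addr_ge0//.
by rewrite sumr_ge0// => i _; rewrite sumr_ge0.
Qed.

Lemma integrable_speed T : 0 <= T -> mu.-integrable `[0, T] (EFin \o speed).
Proof.
move=> T0; have -> : EFin \o speed =
    (cst 1%E \+ (fun s => \sum_k \sum_j `|(v s k j)%:E|))%E.
  apply/funext => s; rewrite /speed /= EFinD; congr (_ + _)%E.
  rewrite -sumEFin; apply: eq_bigr => k _.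
  by rewrite -sumEFin.
apply: integrableD => //.
  apply: measurable_bounded_integrable => //.
    by rewrite /= lebesgue_measure_itv/=; case: ifP => _; rewrite ?ltry// -EFinD ltry.
  by exists 1; split => // M M1 x _ /=; rewrite normr1 ltW.
apply: integrable_sum => // k _; apply: integrable_sum => // j _.
by apply/integrable_abse/intv.
Qed.

Section horizon.
Variable T : R.
Hypothesis T0 : 0 <= T.

Let sub_itv s t : 0 <= s -> t <= T -> `]s, t] `<=` `[0, T].
Proof.
move=> s0 tT x; rewrite /= !in_itv/= => /andP[sx xt].
by rewrite (le_trans s0 (ltW sx)) (le_trans xt).
Qed.

Let integrable_sub (g : R -> R) s t : 0 <= s -> t <= T ->
  mu.-integrable `[0, T] (EFin \o g) -> mu.-integrable `]s, t] (EFin \o g).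
Proof. by move=> s0 tT; apply: integrableS => //; exact: sub_itv. Qed.

Lemma travel_bounded s t : 0 <= s -> s <= t -> t <= T ->
  0 <= travel s t <= \int[mu]_(x in `[0, T]) speed x.
Proof.
move=> s0 st tT; have speed0 x : 0 <= speed x by exact: le_trans (speed_ge1 x).
have int := integrable_speed T T0.
apply/andP; split; first exact: Rintegral_ge0.
rewrite /travel /Rintegral fine_le//.
- by apply: integrable_fin_num => //; exact: integrable_sub.
- exact: integrable_fin_num.
apply: ge0_subset_integral => //; last exact: sub_itv.
  by have /integrableP[] := int.
by move=> x _; rewrite lee_fin.
Qed.

Lemma coord_le_travel k j s t : 0 <= s -> s <= t -> t <= T ->
  `|theta t k j - theta s k j| <= travel s t.
Proof.
move=> s0 st tT; have t0 := le_trans s0 st.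
have intvT : mu.-integrable `[0, T] (EFin \o (fun x => v x k j)).
  exact: intv.
rewrite (thetaE k j t t0) (thetaE k j s s0) opprD addrACA subrr add0r.
have -> : \int[mu]_(x in `[0, t]) v x k j - \int[mu]_(x in `[0, s]) v x k j =
    \int[mu]_(x in `]s, t]) v x k j.
  by apply: Rintegral_itvB; rewrite ?bnd_simp//; exact: intv.
apply: le_trans (le_normr_Rintegral _ _) _ => //; first exact: integrable_sub.
apply: le_Rintegral => //.
- by apply: integrable_norm; exact: integrable_sub.
- by apply: integrable_sub => //; exact: integrable_speed.
- by move=> x _; exact: coord_le_speed.
Qed.

Lemma gauged_coord k j : gauged T travel (fun t => theta t k j).
Proof. by exists 1 => // s t *; rewrite mul1r; exact: coord_le_travel. Qed.

Lemma gauged_id : gauged T travel id.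
Proof.
exists 1 => // s t s0 st tT; rewrite mul1r ger0_norm ?subr_ge0//.
have intT : mu.-integrable `]s, t] (EFin \o speed).
  by apply: integrable_sub => //; exact: integrable_speed.
have int1 : mu.-integrable `]s, t] (EFin \o (fun=> 1)).
  apply: measurable_bounded_integrable => //.
    by rewrite /= lebesgue_measure_itv/=; case: ifP => _; rewrite ?ltry// -EFinD ltry.
  by exists 1; split => // M M1 x _ /=; rewrite normr1 ltW.
apply: (@le_trans _ _ (\int[mu]_(x in `]s, t]) 1)).
  rewrite Rintegral_cst// mul1r /= lebesgue_measure_itv/= lte_fin.
  move: st; rewrite le_eqVlt => /predU1P[->|st]; first by rewrite ltxx subrr.
  by rewrite st -EFinB.
by apply: le_Rintegral => // x _; exact: speed_ge1.
Qed.

Lemma gauged_expR a : gauged T travel (fun t => expR (a * t)).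
Proof.
have [C C0 idC] := gauged_id.
exists (expR (`|a| * T) * `|a| * C); first by rewrite !mulr_ge0// expR_ge0.
(* A Lipschitz bound below [K], drawn from 1 + z <= exp z at z = y - x. *)
have expR_lip (x y K : R) : x <= K -> y <= K -> expR x - expR y <= expR K * `|x - y|.
  move=> xK yK; have H := expR_ge1Dx (y - x).
  have -> : expR x - expR y = expR x * (1 - expR (y - x)).
    by rewrite mulrBr mulr1 -expRD subrKC.
  apply: (@le_trans _ _ (expR x * `|x - y|)).
    rewrite ler_wpM2l ?expR_ge0//; apply: le_trans (ler_norm _); lra.
  by rewrite ler_wpM2r// ler_expR.
move=> s t s0 st tT.
have aK r : 0 <= r -> r <= T -> a * r <= `|a| * T.
  move=> r0 rT; apply: le_trans (ler_norm _) _.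
  by rewrite normrM ler_wpM2l// ger0_norm.
apply: (@le_trans _ _ (expR (`|a| * T) * `|a * t - a * s|)).
  have t0 := le_trans s0 st; have sT := le_trans st tT.
  rewrite ler_norml expR_lip ?aK// andbT lerNl opprB distrC.
  by rewrite expR_lip ?aK.
rewrite -mulrBr normrM -!mulrA ler_wpM2l ?expR_ge0// ler_wpM2l//.
exact: idC.
Qed.

Lemma gauged_risk : gauged T travel (fun t => RS (theta t)).
Proof.
have gM h1 h2 := @gaugedM R T _ travel travel_bounded h1 h2.
have gres i : gauged T travel (fun t => residual A b c f X (theta t) i).
  apply: gaugedD; last exact: gauged_cst.
  under eq_fun do rewrite pde_netE; apply: gauged_sum => k.
  apply: (gM _ _); first by under eq_fun do rewrite outerE; exact: gauged_coord.
  apply: gauged_neuron => [|j]; first exact: travel_bounded.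
  by under eq_fun do rewrite innerE; exact: gauged_coord.
apply: (gM _ _); first exact: gauged_cst.
by apply: gauged_sum => i; under eq_fun do rewrite expr2; apply: (gM _ _); exact: gres.
Qed.

(** The passage from infinitesimal to integrated estimates. It serves below for the weighted risk
    and for each signed coordinate. *)
Lemma flow_nonincreasing h : gauged T travel h ->
  (forall t, 0 < t < T -> flow_time t -> exists2 l, is_derive t 1 h l & l <= 0) ->
  h T <= h 0.
Proof.
move=> [C C0 hC] dh.
apply: (@ae_nonincreasing R speed T C) => //.
- by move=> x; exact: le_trans (speed_ge1 x).
- exact: integrable_speed.
have := ae_flow_time T; apply: filterS; first exact: (ae_filter_ringOfSetsType mu).
by move=> t ft t0T; apply: dh => //; exact: ft.
Qed.

End horizon.

Lemma flow_right_continuous t e : 0 <= t -> 0 < e -> exists2 r, 0 < r &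
  forall s, t <= s < t + r -> forall k j, `|theta s k j - theta t k j| < e.
Proof.
move=> t0 e0; have t10 : 0 <= t + 1 by rewrite addr_ge0.
have int := integrable_speed _ t10.
have [r r0 small] := @small_integral R _ _ _ (measurable_itv _) int e0.
(* The cap 1 keeps s within the horizon t + 1 on which [speed] was integrated. *)
exists (Num.min 1 r); first by rewrite lt_min ltr01.
move=> s /andP[ts str] k j.
have [s1 sr] : s <= t + 1 /\ s - t < r.
  by move: str; rewrite -ltrBlDl lt_min => /andP[h1 h2]; split; rewrite // -lerBlDl ltW.
apply: le_lt_trans (coord_le_travel _ t10 k j _ _ t0 ts s1) _.
rewrite /travel; apply: small => //.
  move=> x; rewrite /= !in_itv/= => /andP[tx xs].
  by rewrite (le_trans t0 (ltW tx)) (le_trans xs).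
rewrite lebesgue_measure_itv/= lte_fin.
by case: ifP => _; rewrite ?lte_fin// -EFinB lte_fin.
Qed.

End flow.

(** * Exponential decay near a well-conditioned initialization *)

Section decay.
Context {R : realType} {d m n : nat}.
Variables (A : 'cV[R]_d -> 'M[R]_d) (b : 'cV[R]_d -> 'cV[R]_d)
  (c f : 'cV[R]_d -> R) (M : R) (X : 'I_n -> 'cV[R]_d).
Hypotheses (M0 : 0 <= M) (Abc : bounded_coefficients A b c M)
  (cX : forall i, cube (X i)) (m_gt0 : (0 < m)%N) (n_gt0 : (0 < n)%N).

Let RS : 'M[R]_(m, 1 + d) -> R := emp_risk A b c f X.
Let e := @residual R d m n A b c f X.
Local Notation N theta k i := (neuron A b c (inner theta k) (X i)).

Definition gram (theta : 'M[R]_(m, 1 + d)) i j : R := m%:R^-1 * \sum_k N theta k i * N theta k j.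

Variables (K : 'M[R]_n) (lam rho r : R) (theta0 : 'M[R]_(m, 1 + d)).
Hypotheses (lam0 : 0 < lam) (rho0 : 0 < rho) (rrho : r <= rho).
Hypothesis Klam : forall u : 'rV[R]_n,
  lam * \sum_i u 0 i ^+ 2 <= \sum_i \sum_j u 0 i * u 0 j * K i j.
Hypothesis gramK : forall i j, `|gram theta0 i j - K i j| <= lam / (4 * n%:R).
Hypothesis theta0_le : forall k j, `|theta0 k j| <= rho.
Hypothesis r_small : 1600 / 3 * M ^+ 2 * d%:R ^+ 6 * rho ^+ 5 * r <= lam / (4 * n%:R).

Let mR : 0 < m%:R :> R. Proof. by rewrite ltr0n. Qed.
Let nR : 0 < n%:R :> R. Proof. by rewrite ltr0n. Qed.

Definition near_init (theta : 'M[R]_(m, 1 + d)) := forall k j, `|theta k j - theta0 k j| <= r.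

Section ball.
Variable theta : 'M[R]_(m, 1 + d).
Hypothesis th_near : near_init theta.

Let th_le k j : `|theta k j| <= 2 * rho.
Proof.
rewrite -[theta k j](subrK (theta0 k j)); apply: le_trans (ler_normD _ _) _.
have := th_near k j; have := theta0_le k j; move: rrho; lra.
Qed.

Lemma inner_norm1_le k : norm1 (inner theta k) <= d%:R * (2 * rho).
Proof. by apply: norm1_le_max => j; rewrite innerE. Qed.

Let inner0_norm1_le k : norm1 (inner theta0 k) <= d%:R * (2 * rho).
Proof.
apply: norm1_le_max => j; rewrite innerE; apply: le_trans (theta0_le _ _) _.
by move: rho0; lra.
Qed.

Let neuron_cap w i : norm1 w <= d%:R * (2 * rho) ->
  `|neuron A b c w (X i)| <= 40 / 3 * M * d%:R ^+ 3 * rho ^+ 3.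
Proof.
move=> wr; apply: le_trans (neuron_le _ _ _ _ _ Abc (cX i) w) _.
have -> : 40 / 3 * M * d%:R ^+ 3 * rho ^+ 3 = 5 / 3 * M * (d%:R * (2 * rho)) ^+ 3.
  by field.
by rewrite ler_wpM2l ?mulr_ge0// lerXn2r ?nnegrE ?norm1_ge0// (le_trans _ wr) ?norm1_ge0.
Qed.

Lemma neuron_near_le k i : `|N theta k i| <= 40 / 3 * M * d%:R ^+ 3 * rho ^+ 3.
Proof. exact/neuron_cap/inner_norm1_le. Qed.

Let neuron_drift k i :
  `|N theta k i - N theta0 k i| <= 20 * M * d%:R ^+ 3 * rho ^+ 2 * r.
Proof.
apply: le_trans (neuron_lipschitz _ _ _ _ _ Abc (cX i) _ _ _
  (inner_norm1_le k) (inner0_norm1_le k)) _.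
have -> : 20 * M * d%:R ^+ 3 * rho ^+ 2 * r =
  5 * M * (d%:R * (2 * rho)) ^+ 2 * (d%:R * r) by field.
rewrite ler_wpM2l//; first by rewrite mulr_ge0 ?sqr_ge0// mulr_ge0.
apply: norm1_le_max => j; rewrite mxE [X in _ + X]mxE !innerE; exact: th_near.
Qed.

(** A difference of products splits into two terms, each at most (40/3) 20 M^2 d^6 rho^5 r, whence
    1600/3. As parameters stay below 2 rho, 40/3 is 5/3 times 2^3 (size of a neuron) and 20 is 5
    times 2^2 (its Lipschitz constant). *)
Lemma gram_near i j : `|gram theta i j - K i j| <= lam / (2 * n%:R).
Proof.
have -> : lam / (2 * n%:R) = lam / (4 * n%:R) + lam / (4 * n%:R).
  by field; rewrite gt_eqF.
rewrite -(subrK (gram theta0 i j) (gram theta i j)) -addrA.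
apply: le_trans (ler_normD _ _) _; rewrite lerD//.
apply: le_trans r_small; rewrite /gram -mulrBr -sumrB normrM ger0_norm ?invr_ge0//.
rewrite ler_pdivrMl//; apply: le_trans (ler_norm_sum _ _ _) _.
apply: (@le_trans _ _ (\sum_(k < m) (1600 / 3 * M ^+ 2 * d%:R ^+ 6 * rho ^+ 5 * r))).
  apply: ler_sum => k _.
  rewrite (_ : _ - _ = N theta k i * (N theta k j - N theta0 k j)
    + (N theta k i - N theta0 k i) * N theta0 k j); last by ring.
  apply: le_trans (ler_normD _ _) _.
  apply: le_trans (lerD (ler_normM _ _ _ _ _ (neuron_near_le k i) (neuron_drift k j))
    (ler_normM _ _ _ _ _ (neuron_drift k i) (neuron_cap _ j (inner0_norm1_le k)))) _.
  by rewrite le_eqVlt; apply/orP; left; apply/eqP; field.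
by rewrite sumr_const card_ord [leRHS]mulr_natl.
Qed.

Lemma gram_coercive (u : 'rV[R]_n) :
  m%:R * lam / 2 * \sum_i u 0 i ^+ 2 <= \sum_k (\sum_i u 0 i * N theta k i) ^+ 2.
Proof.
have -> : \sum_k (\sum_i u 0 i * N theta k i) ^+ 2 =
    m%:R * \sum_i \sum_j u 0 i * u 0 j * gram theta i j.
  rewrite mulr_sumr; under eq_bigr do rewrite expr2 big_distrlr/=.
  rewrite exchange_big/=; apply: eq_bigr => i _.
  rewrite mulr_sumr exchange_big/=; apply: eq_bigr => j _.
  rewrite /gram mulrCA (mulrA m%:R) mulfV ?gt_eqF// mul1r mulr_sumr.
  by apply: eq_bigr => k _; ring.
rewrite -!mulrA ler_pM2l// mulrA.
(* Entrywise errors lambda / (2 n) cost lambda / (2 n) times the squared 1-norm of u, hence at most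
   lambda / 2 times its squared Euclidean norm. *)
have pert : `|\sum_i \sum_j u 0 i * u 0 j * (gram theta i j - K i j)| <=
    lam / 2 * \sum_i u 0 i ^+ 2.
  apply: (@le_trans _ _ (lam / (2 * n%:R) * (\sum_i `|u 0 i|) ^+ 2)).
    rewrite expr2 big_distrlr/= mulr_sumr; apply: le_trans (ler_norm_sum _ _ _) _.
    apply: ler_sum => i _; rewrite mulr_sumr; apply: le_trans (ler_norm_sum _ _ _) _.
    by apply: ler_sum => j _; rewrite !normrM mulrC ler_wpM2r ?mulr_ge0// gram_near.
  have := sqr_sum_le _ (fun i => `|u 0 i|); rewrite card_ord.
  have l0 : 0 <= lam / (2 * n%:R) by rewrite divr_ge0 ?mulr_ge0// ltW.
  move=> /(ler_wpM2l l0) /le_trans; apply.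
  rewrite mulrA ler_pM//; last by apply: ler_sum => i _; rewrite real_normK ?num_real.
  - by rewrite mulr_ge0.
  - by apply: sumr_ge0 => i _; exact: sqr_ge0.
  by rewrite le_eqVlt; apply/orP; left; apply/eqP; field; rewrite gt_eqF.
have -> : \sum_i \sum_j u 0 i * u 0 j * gram theta i j =
    \sum_i \sum_j u 0 i * u 0 j * K i j
    + \sum_i \sum_j u 0 i * u 0 j * (gram theta i j - K i j).
  rewrite -big_split/=; apply: eq_bigr => i _; rewrite -big_split/=.
  by apply: eq_bigr => j _; ring.
have := Klam u; move: pert; rewrite ler_norml => /andP[+ _].
by lra.
Qed.

(** Apply the coercivity to the residual vector, whose squared norm is 2 n R_S: (1 / n^2) (m lambda
    / 2) (2 n) = m lambda / n. *)
Lemma risk_dissipation :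
  m%:R * lam / n%:R * RS theta <=
  (n%:R ^+ 2)^-1 * \sum_k (\sum_i e theta i * N theta k i) ^+ 2.
Proof.
have := gram_coercive (\row_i e theta i).
under eq_bigr do rewrite mxE.
under [X in _ <= X -> _]eq_bigr do under eq_bigr do rewrite mxE.
move=> H; rewrite ler_pdivlMl ?exprn_gt0//; apply: le_trans H.
rewrite /RS riskE -/e le_eqVlt; apply/orP; left; apply/eqP.
by field; rewrite gt_eqF.
Qed.

End ball.

Notation mu := (@lebesgue_measure R).
Variables (theta v : R -> 'M[R]_(m, 1 + d)).
Hypothesis intv : forall i j t, 0 <= t ->
  mu.-integrable `[0, t] (fun s => (v s i j)%:E).
Hypothesis thetaE : forall i j t, 0 <= t ->
  theta t i j = theta0 i j + \int[mu]_(s in `[0, t]) v s i j.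
Hypothesis clarke : {ae mu, forall s : R, 0 <= s ->
  clarke_gradient RS (theta s) (- v s)}.

(** The integral over [0, +oo[ of the decaying speed bound used in [drift_on]: 2 / rate times [cap]
    sqrt (2 R_S(theta0)). *)
Let D : R := 80 * Num.sqrt 2 * n%:R * M * d%:R ^+ 3 * rho ^+ 3
  * Num.sqrt (RS theta0) / (m%:R * lam).
Hypothesis drift_small : D < r.

Let rate : R := m%:R * lam / n%:R.
Let rate_gt0 : 0 < rate. Proof. by rewrite divr_gt0// mulr_gt0. Qed.
(** The inner weights need d (2 rho) 5 M (2 d rho)^2, which is this value; the outer ones need a
    third of it. *)
Let cap : R := 40 * M * d%:R ^+ 3 * rho ^+ 3.
Let cap_ge0 : 0 <= cap.
Proof. by rewrite !mulr_ge0// ?exprn_ge0// ltW. Qed.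

Lemma speed_near t k j : flow_time A b c f X theta v t -> near_init (theta t) ->
  `|v t k j| <= cap * Num.sqrt (2 * RS (theta t)).
Proof.
move=> [_ reg cg] nt; set s := Num.sqrt _.
have s0 : 0 <= s by exact: sqrtr_ge0.
case: (split_ordP j) => j' ->.
  rewrite [j']ord1 -outerE (flow_outer _ _ _ _ _ _ _ cg) normrN normrM.
  rewrite ger0_norm ?invr_ge0// mulrC.
  apply: (@le_trans _ _ ((\sum_i `|e (theta t) i| * cap) / n%:R)).
    rewrite ler_wpM2r ?invr_ge0//; apply: le_trans (ler_norm_sum _ _ _) _.
    apply: ler_sum => i _; rewrite normrM ler_wpM2l//.
    apply: le_trans (neuron_near_le _ nt k i) _.
    have -> : 40 / 3 * M * d%:R ^+ 3 * rho ^+ 3 = cap / 3 by rewrite /cap; field.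
    by move: cap_ge0; move: (cap) => y y0; lra.
  rewrite -mulr_suml mulrAC mulrC ler_wpM2l// mulrC.
  exact: mean_residual_le.
rewrite -innerE; apply: le_trans (coord_le_norm1 _ _) _.
apply: le_trans (flow_inner_le _ _ _ _ _ _ M0 Abc cX _ _ cg reg k) _.
have -> : cap * s = d%:R * (s * (2 * rho * (5 * M * (d%:R * (2 * rho)) ^+ 2))).
  by rewrite /cap; field.
rewrite ler_wpM2l// ler_wpM2l// ler_pM//.
- by rewrite !mulr_ge0// ?exprn_ge0// norm1_ge0.
- rewrite outerE -[theta t _ _](subrK (theta0 k (lshift d 0))).
  apply: le_trans (ler_normD _ _) _.
  have := nt k (lshift d 0); have := theta0_le k (lshift d 0); move: rrho; lra.
- rewrite ler_wpM2l ?mulr_ge0// lerXn2r ?nnegrE ?norm1_ge0//.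
    by rewrite !mulr_ge0// ltW.
  exact: inner_norm1_le.
Qed.

Lemma decay_on T : 0 <= T -> (forall t, 0 < t < T -> near_init (theta t)) ->
  RS (theta T) <= expR (- (rate * T)) * RS theta0.
Proof.
move=> T0 stay.
have gM h1 h2 := @gaugedM R T _ _ (travel_bounded _ intv T T0) h1 h2.
(* Gronwall's weight: the derivative of R_S exp(rate t) is exp(rate t) (rate R_S - |v|^2),
   nonpositive while the flow stays near its start. *)
have := flow_nonincreasing _ _ _ _ _ _ _ _ intv thetaE clarke T T0
  (fun t => RS (theta t) * expR (rate * t)).
rewrite (flow_theta0 _ _ _ thetaE) mulr0 expR0 mulr1 => H.
rewrite expRN mulrC ler_pdivlMr ?expR_gt0//; apply: H.
  by apply: (gM _ _); [exact: (gauged_risk _ _ _ _ _ _ _ _ intv thetaE T T0)|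
    exact: (gauged_expR _ intv T T0)].
move=> t t0T /[dup] ft [dth reg cg].
exists (RS (theta t) * (rate * expR (rate * t))
  + expR (rate * t) * risk_diff A b c f X (theta t) (v t)).
  have dR := is_derive_risk A b c f _ _ _ _ dth reg.
  have dE : is_derive t 1 (fun s => expR (rate * s)) (rate * expR (rate * t)).
    have dl : is_derive t 1 (fun s : R => rate * s) rate.
      rewrite (_ : (fun s => _) = rate \*: id) //.
      by apply: is_derive_eq; rewrite [_%:A]mulr1.
    apply: is_derive_eq (is_derive1_comp (is_derive_expR _) dl) _.
    by rewrite mulrC.
  exact: (is_deriveM dR dE).
rewrite (flow_risk_diff _ _ _ _ _ _ _ cg reg).
have nt := stay t t0T.
have H1 := risk_dissipation _ nt.
have H2 := flow_dissipation _ _ _ _ _ _ _ cg.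
rewrite (_ : _ + _ = expR (rate * t) * (rate * RS (theta t) - mxdot (v t) (v t))); last by ring.
rewrite mulr_ge0_le0 ?expR_ge0// subr_le0.
exact: le_trans H1 H2.
Qed.

(** Each signed coordinate plus (2 Q / rate) exp(- rate t / 2) is nonincreasing: the exponential
    decreases at the speed that bounds the coordinate. The rate is halved because the speed is of
    order sqrt R_S. *)
Lemma drift_on T k j : 0 <= T -> (forall t, 0 <= t < T -> near_init (theta t)) ->
  `|theta T k j - theta0 k j| <= D.
Proof.
move=> T0 stay; pose Q := cap * Num.sqrt 2 * Num.sqrt (RS theta0).
have speed_le t : 0 < t < T -> flow_time A b c f X theta v t ->
    `|v t k j| <= Q * expR (- (rate / 2) * t).
  move=> /andP[t0 tT] ft; have nt : near_init (theta t).
    by apply: stay; rewrite ltW.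
  apply: le_trans (speed_near _ _ _ ft nt) _.
  rewrite /Q -2!(mulrA cap) -(mulrA (Num.sqrt 2)) ler_wpM2l// sqrtrM//.
  rewrite ler_wpM2l ?sqrtr_ge0//.
  have /(ler_wsqrtr) := decay_on t (ltW t0) (fun s st =>
    stay s (introT andP (conj (ltW (proj1 (andP st))) (lt_trans (proj2 (andP st)) tT)))).
  move=> /le_trans; apply; rewrite sqrtrM ?expR_ge0// mulrC ler_wpM2l ?sqrtr_ge0//.
  have -> : - (rate * t) = - (rate / 2) * t + - (rate / 2) * t by field.
  by rewrite expRD -expr2 sqrtr_sqr ger0_norm ?expR_ge0.
have half s : (s = 1 \/ s = -1) -> s * (theta T k j - theta0 k j) <= Q * (2 / rate).
  move=> s1; have sv t : s * v t k j <= `|v t k j|.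
    by case: s1 => ->; rewrite ?mul1r ?mulN1r ?ler_norm// -[leRHS]normrN ler_norm.
  have Q0 : 0 <= Q by rewrite /Q mulr_ge0 ?sqrtr_ge0// mulr_ge0 ?sqrtr_ge0.
  have gM h1 h2 := @gaugedM R T _ _ (travel_bounded _ intv T T0) h1 h2.
  have := flow_nonincreasing _ _ _ _ _ _ _ _ intv thetaE clarke T T0
    (fun t => s * theta t k j + Q * (2 / rate) * expR (- (rate / 2) * t)).
  rewrite (flow_theta0 _ _ _ thetaE) mulr0 expR0 mulr1 => H.
  rewrite mulrBr lerBlDl; apply: le_trans (H _ _).
  - by rewrite lerDl mulr_ge0 ?expR_ge0// mulr_ge0// divr_ge0// ltW.
  - apply: gaugedD.
      by apply: (gM _ _); [exact: gauged_cst|exact: (gauged_coord _ _ _ intv thetaE T T0)].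
    by apply: (gM _ _); [exact: gauged_cst|exact: (gauged_expR _ intv T T0)].
  move=> t t0T /[dup] ft [dth _ _].
  exists (s * v t k j + Q * (2 / rate) * (- (rate / 2) * expR (- (rate / 2) * t))).
    have dE : is_derive t 1 (fun s => expR (- (rate / 2) * s))
        (- (rate / 2) * expR (- (rate / 2) * t)).
      have dl : is_derive t 1 (fun s : R => - (rate / 2) * s) (- (rate / 2)).
        rewrite (_ : (fun s => _) = (- (rate / 2)) \*: id) //.
        by apply: is_derive_eq; rewrite [_%:A]mulr1.
      apply: is_derive_eq (is_derive1_comp (is_derive_expR _) dl) _.
      by rewrite mulrC.
    exact: (is_deriveD (is_deriveZ s (dth k j)) (is_deriveZ (Q * (2 / rate)) dE)).
  have := le_trans (sv t) (speed_le t t0T ft).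
  have -> : Q * (2 / rate) * (- (rate / 2) * expR (- (rate / 2) * t)) =
    - (Q * expR (- (rate / 2) * t)) by field; rewrite gt_eqF.
  by rewrite subr_le0.
have -> : D = Q * (2 / rate).
  by rewrite /D /Q /cap /rate; field; rewrite !gt_eqF.
rewrite ler_norml lerNl -mulN1r half; last by right.
by rewrite -[theta T k j - _]mul1r half//; left.
Qed.

(** [drift_on] uses only times before t but bounds the drift at t by [D], and the slack r - D pays
    for a short interval after t. *)
Lemma flow_stays t : 0 <= t -> near_init (theta t).
Proof.
move: t; apply: real_induction => t t0 stay.
have drift k j := drift_on t k j t0 stay.
have e0 : 0 < r - D by rewrite subr_gt0.
have [y y0 hy] := flow_right_continuous _ _ _ intv thetaE _ _ t0 e0.
exists y => // s /hy sy k j.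
rewrite -(subrK (theta t k j) (theta s k j)) -addrA -[leRHS](subrK D).
by apply: le_trans (ler_normD _ _) _; rewrite lerD// ltW.
Qed.

Lemma flow_decay t : 0 <= t ->
  RS (theta t) <= expR (- (m%:R * lam * t / n%:R)) * RS theta0.
Proof.
move=> t0; rewrite [m%:R * lam * t / _]mulrAC; apply: decay_on => // s /andP[s0 _].
by apply: flow_stays; exact: ltW.
Qed.

End decay.

(** * Gaussian moments and tails *)

Section normal_moments.
Context {R : realType}.
Notation mu := (@lebesgue_measure R).

(** The Radon-Nikodym derivative of the normal law agrees almost everywhere with its density, both
    having the same integral over every measurable set. *)
Lemma ge0_integral_normal_prob (m s : R) (f : R -> \bar R) :
  measurable_fun setT f -> (forall x, 0 <= f x)%E ->
  (\int[normal_prob m s]_x f x = \int[mu]_x (f x * (normal_pdf m s x)%:E))%E.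
Proof.
move=> mf f0; have dom := normal_prob_dominates m s.
rewrite -(Radon_Nikodym_SigmaFinite.change_of_variables dom)//.
have pdf_ge0 x : (0 <= (normal_pdf m s x)%:E)%E by rewrite lee_fin normal_pdf_ge0.
have mpdf : measurable_fun setT (fun x => (normal_pdf m s x)%:E).
  by apply/measurable_EFinP; exact: measurable_normal_pdf.
have irn := Radon_Nikodym_SigmaFinite.f_integrable dom.
apply: ge0_ae_eq_integral => //.
- by apply: emeasurable_funM => //; exact: (measurable_int mu).
- exact: emeasurable_funM.
- by move=> x _; rewrite mule_ge0// Radon_Nikodym_SigmaFinite.f_ge0.
- by move=> x _; rewrite mule_ge0.
apply: ae_eqe_mul2l; apply: integral_ae_eq => //.
by move=> E _ mE; rewrite -Radon_Nikodym_SigmaFinite.f_integral.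
Qed.

(* Completing the square: exp (t x) times the density of N(0, s^2) is
   exp (t^2 s^2 / 2) times the density of N(t s^2, s^2). *)
Lemma normal_mgf (s t : R) : s != 0 ->
  (\int[normal_prob 0 s]_x (expR (t * x))%:E = (expR (t ^+ 2 * s ^+ 2 / 2))%:E)%E.
Proof.
move=> s0; rewrite ge0_integral_normal_prob; last 2 first.
- by apply/measurable_EFinP; apply: measurableT_comp => //; exact: measurable_funM.
- by move=> x; rewrite lee_fin expR_ge0.
set k := expR (t ^+ 2 * s ^+ 2 / 2).
have mpdf : measurable_fun setT (fun x : R => (normal_pdf (t * s ^+ 2) s x)%:E).
  by apply/measurable_EFinP; exact: measurable_normal_pdf.
have pdf0 (x : R) : setT x -> (0 <= (normal_pdf (t * s ^+ 2) s x)%:E)%E.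
  by move=> _; rewrite lee_fin normal_pdf_ge0.
have k0 : (0 <= k%:E)%E by rewrite lee_fin expR_ge0.
have := ge0_integralZl mu measurableT mpdf pdf0 k0.
rewrite integral_normal_pdf mule1 => <-.
apply: eq_integral => x _; rewrite -!EFinM; congr EFin.
rewrite /k /normal_pdf (negbTE s0) /normal_fun mulrCA [RHS]mulrCA -!expRD.
congr (_ * expR _).
by rewrite -[in LHS]mulr_natr -[in RHS]mulr_natr; field.
Qed.

End normal_moments.

Section law_transfer.
Context d {T : measurableType d} {R : realType} (P : probability T R).
Context d' {T' : measurableType d'} (mu : probability T' R).
Variable X : {RV P >-> T'}.
Hypothesis lawX : has_law X mu.

Lemma ge0_integral_law (f : T' -> \bar R) :
  measurable_fun setT f -> (forall y, 0 <= f y)%E ->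
  (\int[P]_x f (X x) = \int[mu]_y f y)%E.
Proof.
move=> mf f0; rewrite -[LHS]/(\int[P]_x (f \o X) x)%E -ge0_integral_distribution//.
by apply: eq_measure_integral => B mB _; exact: lawX.
Qed.

Lemma integrable_law (f : T' -> \bar R) :
  mu.-integrable setT f -> P.-integrable setT (fun x => f (X x)).
Proof.
move=> /integrableP[mf intf]; apply/integrableP; split.
  by apply: measurableT_comp.
rewrite (ge0_integral_law (fun y => `|f y|)%E)//.
exact: measurableT_comp.
Qed.

Lemma integral_law (f : T' -> \bar R) : mu.-integrable setT f ->
  (\int[P]_x f (X x) = \int[mu]_y f y)%E.
Proof.
move=> intf; have mf : measurable_fun setT f by have /integrableP[] := intf.
rewrite -[LHS]/(\int[P]_x (f \o X) x)%E -integral_distribution//.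
  by apply: eq_measure_integral => B mB _; exact: lawX.
exact: integrable_law.
Qed.

End law_transfer.

Lemma integral_probability_cst d (T : measurableType d) (R : realType)
    (P : probability T R) (k : R) : (\int[P]_x k%:E = k%:E)%E.
Proof. by rewrite integral_cst// [X in (_ * X)%E]probability_setT mule1. Qed.

Section gaussian_vector_moments.
Context {R : realType}.

Let ge0_integral_cons d (f : d.+1.-tuple R -> \bar R) :
  measurable_fun setT f -> (forall w, 0 <= f w)%E ->
  (\int[std_gauss d.+1]_w f w =
   \int[normal_prob 0 1]_x \int[std_gauss d]_w f (tuple_cons (x, w)))%E.
Proof.
move=> mf f0; rewrite ge0_integral_distribution// fubini_tonelli1//.
- by apply: measurableT_comp => //; exact: measurable_tuple_cons.
- by move=> x; exact: f0.
Qed.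

Lemma measurable_expR_coord d (t : R) (j : 'I_d) :
  measurable_fun setT (fun w : d.-tuple R => (expR (t * tnth w j))%:E).
Proof.
apply/measurable_EFinP; apply: measurableT_comp => //.
by apply: measurable_funM => //; exact: measurable_tnth.
Qed.

Lemma std_gauss_coord_mgf d (t : R) (j : 'I_d) :
  (\int[std_gauss d]_w (expR (t * tnth w j))%:E = (expR (t ^+ 2 / 2))%:E)%E.
Proof.
elim: d j => [[]//|d IH] j.
rewrite ge0_integral_cons; last 2 first.
- exact: measurable_expR_coord.
- by move=> w; rewrite lee_fin expR_ge0.
case: (unliftP ord0 j) => [j' ->|->].
  under eq_integral do under eq_integral do rewrite tnthS.
  under eq_integral do rewrite IH.
  by rewrite integral_cst// [X in (_ * X)%E]probability_setT mule1.
under eq_integral do under eq_integral do rewrite tnth0/=.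
under eq_integral do rewrite integral_cst// [X in (_ * X)%E]probability_setT mule1.
by rewrite (normal_mgf _ _ (oner_neq0 R)) expr1n mulr1.
Qed.

Lemma measurable_norm1 d :
  measurable_fun setT (fun w : d.-tuple R => norm1 (vec w)).
Proof.
rewrite /norm1; under eq_fun do under eq_bigr do rewrite mxE.
apply: measurable_sum => j; apply: measurableT_comp => //.
exact: measurable_tnth.
Qed.

Let measurable_expR_norm1 d :
  measurable_fun setT (fun w : d.-tuple R => (expR (norm1 (vec w)))%:E).
Proof. by apply/measurable_EFinP; apply: measurableT_comp => //; exact: measurable_norm1. Qed.

Lemma expR_normr_normal_lty :
  (\int[normal_prob 0 1]_x (expR `|x : R|)%:E < +oo)%E.
Proof.
have mexp (t : R) : measurable_fun setT (fun x : R => (expR (t * x))%:E).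
  by apply/measurable_EFinP; apply: measurableT_comp => //; exact: measurable_funM.
apply: (@le_lt_trans _ _
  (\int[normal_prob 0 1]_x ((expR (1 * x))%:E + (expR (- 1 * x))%:E))%E).
  apply: ge0_le_integral => //.
  - by apply/measurable_EFinP; apply: measurableT_comp => //; exact: measurableT_comp.
  - by apply: emeasurable_funD; exact: mexp.
  - move=> x _; rewrite -EFinD lee_fin mul1r mulN1r.
    have [x0|x0] := leP 0 x; first by rewrite ger0_norm// lerDl expR_ge0.
    by rewrite ltr0_norm// lerDr expR_ge0.
rewrite ge0_integralD//; [|exact: mexp..].
by rewrite !(normal_mgf _ _ (oner_neq0 R)) -EFinD ltry.
Qed.

(** The exponential of the 1-norm factorizes over the coordinates, so Fubini reduces the claim to
    one dimension. *)
Lemma expR_norm1_std_gauss_lty d :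
  (\int[std_gauss d]_w (expR (norm1 (vec (w : d.-tuple R))))%:E < +oo)%E.
Proof.
elim: d => [|d IH].
  rewrite [X in (X < _)%E](_ : _ = 1%E) ?ltry//.
  rewrite -(integral_probability_cst _ _ R (std_gauss 0) 1); apply: eq_integral => w _.
  by rewrite /norm1 big_ord0 expR0.
rewrite ge0_integral_cons; last 2 first.
- exact: measurable_expR_norm1.
- by move=> w; rewrite lee_fin expR_ge0.
have -> : (\int[normal_prob 0 1]_x \int[std_gauss d]_w
    (expR (norm1 (vec (tuple_cons (x, w)))))%:E =
  \int[normal_prob 0 1]_x ((expR `|x : R|)%:E *
    \int[std_gauss d]_w (expR (norm1 (vec (w : d.-tuple R))))%:E))%E.
  apply: eq_integral => x _; rewrite -ge0_integralZl//; last exact: measurable_expR_norm1.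
  apply: eq_integral => w _; rewrite -EFinM -expRD; congr (expR _)%:E.
  rewrite /norm1 big_ord_recl mxE tnth0; congr (_ + _).
  by apply: eq_bigr => j _; rewrite !mxE tnthS.
have IH0 : (0 <= \int[std_gauss d]_w (expR (norm1 (vec (w : d.-tuple R))))%:E)%E.
  by apply: integral_ge0 => w _; rewrite lee_fin expR_ge0.
rewrite ge0_integralZr//; last first.
  by apply/measurable_EFinP; apply: measurableT_comp => //; exact: measurableT_comp.
rewrite lte_mul_pinfty ?expR_normr_normal_lty//.
  by apply: integral_ge0 => x _; rewrite lee_fin expR_ge0.
rewrite ge0_fin_numE ?expR_normr_normal_lty//.
by apply: integral_ge0 => x _; rewrite lee_fin expR_ge0.
Qed.

(** [C_norm1] is a [fine], which says nothing about an infinite expectation. Finiteness follows from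
    r^12 <= 12^12 exp r, the twelfth power of r / 12 <= exp (r / 12). *)
Lemma norm1_moment_fin d :
  (\int[std_gauss d]_w (norm1 (vec (w : d.-tuple R)) ^+ 12)%:E = (C_norm1 R d)%:E)%E.
Proof.
rewrite /C_norm1 unlock fineK// ge0_fin_numE; last first.
  by apply: integral_ge0 => w _; rewrite lee_fin exprn_ge0// norm1_ge0.
apply: (@le_lt_trans _ _
  (\int[std_gauss d]_w ((12 ^+ 12)%:E * (expR (norm1 (vec (w : d.-tuple R))))%:E))%E).
  apply: ge0_le_integral => //.
  - by move=> w _; rewrite lee_fin exprn_ge0// norm1_ge0.
  - by apply/measurable_EFinP; apply: measurable_funX; exact: measurable_norm1.
  - by apply: measurable_funeM; exact: measurable_expR_norm1.
  move=> w _; rewrite -EFinM lee_fin -ler_pdivrMl ?exprn_gt0// mulrC -expr_div_n.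
  have r0 := norm1_ge0 (vec w); set r := norm1 _ in r0 *.
  have -> : expR r = expR (r / 12) ^+ 12.
    by rewrite -expRM_natl; congr expR; rewrite mulrC divfK.
  rewrite lerXn2r ?nnegrE ?expR_ge0 ?divr_ge0//.
  by apply: le_trans (expR_ge1Dx _); rewrite lerDr.
rewrite ge0_integralZl//; last exact: measurable_expR_norm1.
by rewrite lte_mul_pinfty ?lee_fin ?exprn_ge0// expR_norm1_std_gauss_lty.
Qed.

End gaussian_vector_moments.

(** * Tail bounds and pairs of independent variables *)

Lemma measurable_normr_ge d (T : measurableType d) (R : realType) (X : T -> R)
    (a : R) : measurable_fun setT X -> measurable [set x | (a <= `|X x|)%R].
Proof.
move=> mX; rewrite -[X in measurable X]setTI.
have mnX : measurable_fun setT (fun x => `|X x|) by exact: measurableT_comp.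
have -> : [set x | (a <= `|X x|)%R] = (fun x => `|X x|) @^-1` `[a, +oo[.
  by apply/seteqP; split => x /=; rewrite in_itv/= andbT.
exact: mnX.
Qed.

Section tails.
Context d {T : measurableType d} {R : realType} (P : probability T R).

(* Chernoff bound for both tails at once: the indicator of a <= |X| is at most
   exp (- a^2) (exp (a X) + exp (- a X)). *)
Lemma subgaussian_tail (X : T -> R) (a : R) : measurable_fun setT X -> 0 < a ->
  (forall t, (\int[P]_x (expR (t * X x))%:E <= (expR (t ^+ 2 / 2))%:E)%E) ->
  (P [set x | (a <= `|X x|)%R] <= (2 * expR (- (a ^+ 2 / 2)))%:E)%E.
Proof.
move=> mX a0 mgfX.
have mexp t : measurable_fun setT (fun x => (expR (t * X x))%:E).
  by apply/measurable_EFinP; apply: measurableT_comp => //; exact: measurable_funM.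
have mA : measurable [set x | (a <= `|X x|)%R].
  exact: measurable_normr_ge.
rewrite [leLHS](_ : _ = \int[P]_x (\1_[set x | (a <= `|X x|)%R] x)%:E)%E; last first.
  by rewrite integral_indic// setIT.
apply: (@le_trans _ _ (\int[P]_x ((expR (- a ^+ 2))%:E *
    ((expR (a * X x))%:E + (expR (- a * X x))%:E)))%E).
  apply: ge0_le_integral => //.
  - by apply/measurable_EFinP; exact: measurable_indic.
  - by apply: measurable_funeM; apply: emeasurable_funD; exact: mexp.
  move=> x _; rewrite -EFinD -EFinM lee_fin indicE.
  case: (boolP (x \in _)) => [|_]; last by rewrite mulr_ge0 ?addr_ge0 ?expR_ge0.
  rewrite inE /= => aX; rewrite mulrDr -!expRD.
  have H : 1 <= expR (- a ^+ 2 + a * `|X x|).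
    rewrite -[leLHS]expR0 ler_expR expr2; have := ler_wpM2l (ltW a0) aX; lra.
  apply: le_trans H _; have [x0|x0] := leP 0 (X x).
    by rewrite ger0_norm// lerDl expR_ge0.
  by rewrite ltr0_norm// mulrN -mulNr lerDr expR_ge0.
rewrite ge0_integralZl//; last 2 first.
- by apply: emeasurable_funD; exact: mexp.
- by move=> x _; rewrite -EFinD lee_fin addr_ge0 ?expR_ge0.
rewrite ge0_integralD//.
apply: (@le_trans _ _ ((expR (- a ^+ 2))%:E *
    ((expR (a ^+ 2 / 2))%:E + (expR (a ^+ 2 / 2))%:E))%E).
  rewrite lee_wpmul2l ?lee_fin ?expR_ge0// leeD ?mgfX//.
  by have := mgfX (- a); rewrite sqrrN.
rewrite -EFinD -EFinM lee_fin mulrDr -expRD.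
have -> : - a ^+ 2 + a ^+ 2 / 2 = - (a ^+ 2 / 2) by field.
by rewrite le_eqVlt; apply/orP; left; apply/eqP; ring.
Qed.

End tails.

Section joint_law.
Context d {T : measurableType d} {R : realType} (P : probability T R).
Context d' {T' : measurableType d'} (mu : probability T' R).

Definition pair_fun (X Y : {mfun T >-> T'}) (x : T) : T' * T' := (X x, Y x).

Lemma measurable_pair_fun X Y : measurable_fun setT (pair_fun X Y).
Proof. by apply: measurable_fun_pair. Qed.

HB.instance Definition _ X Y := isMeasurableFun.Build _ _ _ _ (pair_fun X Y)
  (measurable_pair_fun X Y).

Variables X Y : {RV P >-> T'}.
Hypotheses (lawX : has_law X mu) (lawY : has_law Y mu).
Hypothesis indep : forall B B', measurable B -> measurable B' ->
  P (X @^-1` B `&` Y @^-1` B') = (P (X @^-1` B) * P (Y @^-1` B'))%E.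

Lemma joint_law B : measurable B -> distribution P (pair_fun X Y) B = (mu \x mu)%E B.
Proof.
move=> mB; apply/esym; apply: product_measure_unique => // B1 B2 mB1 mB2.
have -> : (mu B1 * mu B2)%E = (P (X @^-1` B1) * P (Y @^-1` B2))%E.
  by rewrite -lawX// -lawY.
by rewrite -indep.
Qed.

(** Covariances of a centred function vanish: |h(X) h(Y)| <= h(X)^2 + h(Y)^2 gives integrability,
    and Fubini under the product law gives 0. *)
Lemma integral_indep_prod (h : T' -> R) : measurable_fun setT h ->
  mu.-integrable setT (fun y => (h y ^+ 2)%:E) ->
  (\int[mu]_y (h y)%:E = 0)%E ->
  P.-integrable setT (fun x => (h (X x) * h (Y x))%:E) /\
  (\int[P]_x (h (X x) * h (Y x))%:E = 0)%E.
Proof.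
move=> mh inth2 h0.
pose f (z : T' * T') := (h z.1 * h z.2)%:E.
have mf : measurable_fun setT f.
  apply/measurable_EFinP; apply: measurable_funM.
    by apply: measurableT_comp => //; exact: measurable_fst.
  by apply: measurableT_comp => //; exact: measurable_snd.
have intP : P.-integrable setT (f \o pair_fun X Y).
  apply: (@le_integrable _ _ _ _ _ _ _
    (fun x => (h (X x) ^+ 2)%:E + (h (Y x) ^+ 2)%:E)%E) => //.
  - by apply: measurableT_comp => //; exact: measurable_pair_fun.
  - move=> x _; rewrite /f /= lee_fin normrM.
    rewrite [leRHS]ger0_norm ?addr_ge0 ?sqr_ge0//.
    rewrite -(real_normK (num_real (h (X x)))) -(real_normK (num_real (h (Y x)))).
    have := sqr_ge0 (`|h (X x)| - `|h (Y x)|).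
    have := normr_ge0 (h (X x)); have := normr_ge0 (h (Y x)); nra.
  apply: integrableD => //.
    exact: (integrable_law _ _ _ _ _ lawX _ inth2).
  exact: (integrable_law _ _ _ _ _ lawY _ inth2).
split=> //.
have intmu : (mu \x mu)%E.-integrable setT f.
  apply/integrableP; split => //.
  rewrite (eq_measure_integral (distribution P (pair_fun X Y))); last first.
    by move=> B mB _; exact/esym/joint_law.
  rewrite ge0_integral_distribution//; last exact: measurableT_comp.
  by have /integrableP[] := intP.
rewrite -[LHS]/(\int[P]_x (f \o pair_fun X Y) x)%E -integral_distribution//.
rewrite (eq_measure_integral (mu \x mu)%E); last by move=> B mB _; exact: joint_law.
rewrite -integral12_prod_meas1// /fubini_F.
have inth : mu.-integrable setT (fun y => (h y)%:E).
  apply: (@le_integrable _ _ _ _ _ _ _ (fun y => 1%:E + (h y ^+ 2)%:E)%E) => //.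
  - exact/measurable_EFinP.
  - move=> y _; rewrite /= lee_fin [leRHS]ger0_norm ?addr_ge0 ?sqr_ge0//.
    rewrite -(real_normK (num_real (h y))); have := sqr_ge0 (`|h y| - 1); nra.
  by apply: integrableD => //; exact: finite_measure_integrable_cst.
under eq_integral do under eq_integral do rewrite /f /= EFinM.
under eq_integral do rewrite integralZl// h0 mule0.
exact: integral0.
Qed.

End joint_law.

(** * Concentration of the Gram matrix *)

Section mean_concentration.
Context d {T : measurableType d} {R : realType} (P : probability T R).
Context d' {T' : measurableType d'} (mu : probability T' R).
Variables (m : nat) (W : 'I_m -> {RV P >-> T'}).
Hypothesis m_gt0 : (0 < m)%N.
Hypothesis lawW : forall k, has_law (W k) mu.
Hypothesis indepW : forall k l, k != l -> forall B B',
  measurable B -> measurable B' ->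
  P (W k @^-1` B `&` W l @^-1` B') = (P (W k @^-1` B) * P (W l @^-1` B'))%E.
Variables (g : T' -> R) (S : R).
Hypothesis mg : measurable_fun setT g.
Hypothesis gS : (\int[mu]_y (g y ^+ 2)%:E <= S%:E)%E.

Let kappa : R := fine (\int[mu]_y (g y)%:E).
Let h (y : T') : R := g y - kappa.

Let mg2 : measurable_fun setT (fun y => (g y ^+ 2)%:E).
Proof. by apply/measurable_EFinP; exact: measurable_funX. Qed.

Let intg2 : mu.-integrable setT (fun y => (g y ^+ 2)%:E).
Proof.
apply/integrableP; split => //.
under eq_integral do rewrite gee0_abs ?lee_fin ?sqr_ge0//.
by apply: le_lt_trans gS _; rewrite ltry.
Qed.

Let intcst (k : R) : mu.-integrable setT (fun=> k%:E).
Proof. exact: finite_measure_integrable_cst. Qed.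

Let intg : mu.-integrable setT (fun y => (g y)%:E).
Proof.
apply: (@le_integrable _ _ _ _ _ _ _ (fun y => 1%:E + (g y ^+ 2)%:E)%E) => //.
- exact/measurable_EFinP.
- move=> y _; rewrite /= lee_fin [leRHS]ger0_norm ?addr_ge0 ?sqr_ge0//.
  rewrite -(real_normK (num_real (g y))); have := sqr_ge0 (`|g y| - 1); nra.
by apply: integrableD => //; exact: intcst.
Qed.

Let int_g : (\int[mu]_y (g y)%:E = kappa%:E)%E.
Proof. by rewrite fineK//; exact: integrable_fin_num. Qed.

Let mh : measurable_fun setT h.
Proof. by apply: measurable_funB. Qed.

Let int_h : (\int[mu]_y (h y)%:E = 0)%E.
Proof.
under eq_integral do rewrite /h EFinB.
rewrite integralB_EFin//=; last exact: (intcst kappa).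
by rewrite int_g integral_cst// [X in (_ * X)%E]probability_setT mule1 subee.
Qed.

Let inth : mu.-integrable setT (fun y => (h y)%:E).
Proof. by apply: (integrableB measurableT intg (intcst kappa)). Qed.

(** The cross term is written with the centred [h], whose integral is 0; the variance is then the
    second moment minus kappa^2. *)
Let h2E y : (h y ^+ 2)%:E = ((g y ^+ 2)%:E + ((- kappa ^+ 2)%:E + (- 2 * kappa)%:E * (h y)%:E))%E.
Proof. by rewrite -EFinM -!EFinD; congr EFin; rewrite /h; ring. Qed.

Let inth2' : mu.-integrable setT (fun y => ((- kappa ^+ 2)%:E + (- 2 * kappa)%:E * (h y)%:E))%E.
Proof. by apply: integrableD => //; exact: integrableZl. Qed.

Let inth2 : mu.-integrable setT (fun y => (h y ^+ 2)%:E).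
Proof.
under eq_fun do rewrite h2E.
exact: integrableD.
Qed.

Let int_h2_le : (\int[mu]_y (h y ^+ 2)%:E <= S%:E)%E.
Proof.
under eq_integral do rewrite h2E.
rewrite integralD// integralD//; last exact: integrableZl.
rewrite integralZl// int_h mule0 adde0 integral_cst// [X in (_ + _ * X)%E]probability_setT mule1.
apply: le_trans gS; rewrite -[leRHS]adde0 leeD2l// lee_fin oppr_le0.
exact: sqr_ge0.
Qed.

Let Y x : R := m%:R^-1 * \sum_k h (W k x).

Let mY : measurable_fun setT Y.
Proof.
apply: measurable_funM => //; apply: measurable_sum => k.
exact: measurableT_comp.
Qed.

Let hh k l x := (h (W k x) * h (W l x))%:E.

Let hh_indep k l : P.-integrable setT (hh k l) /\
  (\int[P]_x hh k l x <= if k == l then S%:E else 0)%E.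
Proof.
case: eqVneq => [<-|kl].
  have hhE : hh k k = fun x => (h (W k x) ^+ 2)%:E.
    by apply/funext => x; rewrite /hh expr2.
  rewrite hhE; split; first exact: (integrable_law _ _ _ _ _ (lawW k) _ inth2).
  by rewrite (integral_law _ _ _ _ _ (lawW k) _ inth2).
have [? ->] := integral_indep_prod _ _ _ _ _ _ (lawW k) (lawW l)
  (indepW _ _ kl) h mh inth2 int_h.
by split.
Qed.

(** Pairwise independence leaves only the m diagonal terms, against the factor 1 / m^2. *)
Let int_Y2 : (\int[P]_x (Y x ^+ 2)%:E <= (S / m%:R)%:E)%E.
Proof.
have mR : (0 : R) < m%:R by rewrite ltr0n.
have YE x : (Y x ^+ 2)%:E = (((m%:R^-1) ^+ 2)%:E * \sum_k \sum_l hh k l x)%E.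
  rewrite /Y exprMn EFinM; congr (_ * _)%E.
  rewrite expr2 big_distrlr/= -sumEFin; apply: eq_bigr => k _.
  by rewrite -sumEFin.
under eq_integral do rewrite YE.
have intsum k : P.-integrable setT (fun x => \sum_l hh k l x)%E.
  by apply: integrable_sum => // l _; have [] := hh_indep k l.
rewrite integralZl//; last by apply: integrable_sum => // k _; exact: intsum.
rewrite integral_sum//.
apply: (@le_trans _ _ (((m%:R^-1) ^+ 2)%:E * \sum_(k < m) S%:E)%E).
  rewrite lee_wpmul2l ?lee_fin ?sqr_ge0//; apply: lee_sum => k _.
  rewrite integral_sum//; last by move=> l; have [] := hh_indep k l.
  rewrite (bigD1 k)//= -[leRHS]adde0; apply: leeD.
    by have [_] := hh_indep k k; rewrite eqxx.
  apply: sume_le0 => l lk; have [_] := hh_indep k l.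
  by rewrite eq_sym (negbTE lk).
rewrite sumEFin -EFinM lee_fin sumr_const card_ord -mulr_natl.
by rewrite le_eqVlt; apply/orP; left; apply/eqP; field; rewrite gt_eqF.
Qed.

Lemma mean_concentration (eps : R) : 0 < eps ->
  (P [set x | (eps <= `|m%:R^-1 * (\sum_k g (W k x)) - fine (\int[mu]_y (g y)%:E)%E|)%R]
   <= (S / (m%:R * eps ^+ 2))%:E)%E.
Proof.
move=> e0; have mR : (0 : R) < m%:R by rewrite ltr0n.
have -> : [set x | (eps <= `|m%:R^-1 * (\sum_k g (W k x)) - fine (\int[mu]_y (g y)%:E)%E|)%R]
    = [set x | (eps <= `|Y x|)%R].
  apply/seteqP; split => x /=; rewrite /Y sumrB sumr_const card_ord mulrBr -/kappa;
  by rewrite -(mulr_natl kappa) mulrA mulVf ?mul1r// gt_eqF.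
have mB : measurable [set x | (eps <= `|Y x|)%R] by exact: measurable_normr_ge.
rewrite [leLHS](_ : _ = \int[P]_x (\1_[set x | (eps <= `|Y x|)%R] x)%:E)%E; last first.
  by rewrite integral_indic// setIT.
apply: (@le_trans _ _ (\int[P]_x ((eps ^+ 2)^-1%:E * (Y x ^+ 2)%:E))%E).
  apply: ge0_le_integral => //.
  - by apply/measurable_EFinP; exact: measurable_indic.
  - by apply: measurable_funeM; apply/measurable_EFinP; exact: measurable_funX.
  move=> x _; rewrite -EFinM lee_fin indicE.
  case: (boolP (x \in _)) => [|_]; last by rewrite mulr_ge0 ?invr_ge0 ?sqr_ge0.
  rewrite inE /= => eY; rewrite ler_pdivlMl ?exprn_gt0// mulr1.
  by rewrite -[leRHS]real_normK ?num_real// lerXn2r ?nnegrE// ltW.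
rewrite ge0_integralZl//; last 3 first.
- by apply/measurable_EFinP; exact: measurable_funX.
- by move=> x _; rewrite lee_fin sqr_ge0.
- by rewrite lee_fin invr_ge0 sqr_ge0.
apply: (@le_trans _ _ ((eps ^+ 2)^-1%:E * (S / m%:R)%:E)%E).
  by rewrite lee_wpmul2l// lee_fin invr_ge0 sqr_ge0.
by rewrite -EFinM lee_fin le_eqVlt; apply/orP; left; apply/eqP; field; rewrite !gt_eqF.
Qed.

End mean_concentration.

Lemma union_bound d (T : measurableType d) (R : realType) (P : probability T R)
    (I : finType) (B : I -> set T) (q : R) : (forall i, measurable (B i)) ->
  (forall i, (P (B i) <= q%:E)%E) ->
  measurable (\big[setU/set0]_i B i) /\
  (P (\big[setU/set0]_i B i) <= (#|I|%:R * q)%:E)%E.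
Proof.
move=> mB Bq; have -> : #|I|%:R * q = \sum_(i : I) q by rewrite sumr_const mulr_natl.
elim: (index_enum I) => [|i s [ms IH]]; first by rewrite !big_nil measure0.
rewrite !big_cons; split; first exact: measurableU.
apply: le_trans (measureU2 _ _ _) _ => //.
by rewrite EFinD; exact: (leeD (Bq i) IH).
Qed.

Section initialization.
Context {R : realType} {d : nat}.
Variables (A : 'cV[R]_d -> 'M[R]_d) (b : 'cV[R]_d -> 'cV[R]_d)
  (c : 'cV[R]_d -> R) (M : R).
Hypotheses (M0 : 0 <= M) (Abc : bounded_coefficients A b c M).

Lemma measurable_vec_coord (j : 'I_d) :
  measurable_fun setT (fun w : d.-tuple R => vec w j 0).
Proof.
rewrite (_ : (fun w => _) = (fun w : d.-tuple R => tnth w j)).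
  exact: measurable_tnth.
by apply/funext => w; rewrite mxE.
Qed.

Lemma measurable_vec_dot (y : 'cV[R]_d) :
  measurable_fun setT (fun w : d.-tuple R => dot y (vec w)).
Proof.
under eq_fun do rewrite dotE; apply: measurable_sum => j.
by apply: measurable_funM => //; exact: measurable_vec_coord.
Qed.

Lemma measurable_neuron (x : 'cV[R]_d) :
  measurable_fun setT (fun w : d.-tuple R => neuron A b c (vec w) x).
Proof.
have ms : measurable_fun setT (fun w : d.-tuple R => sigma2 (dot (vec w) x)).
  apply: measurableT_comp.
    by apply: continuous_measurable_fun; exact: sigma2_continuous.
  by under eq_fun do rewrite dotC; exact: measurable_vec_dot.
under eq_fun do rewrite neuronE; apply: measurable_funD; first apply: measurable_funD.
- apply: measurable_funM => //; apply: measurable_sum => i; apply: measurable_sum => j.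
  by apply: measurable_funM; first apply: measurable_funM => //; exact: measurable_vec_coord.
- apply: measurable_funM; first exact: measurable_vec_dot.
  by apply: measurable_funM => //; exact: measurable_funX.
- apply: measurable_funM => //.
  by apply: measurable_funM => //; exact: measurable_funX.
Qed.

Lemma measurable_g_a (x y : 'cV[R]_d) :
  measurable_fun setT (fun w : d.-tuple R => g_a A b c (vec w) x y).
Proof. by apply: measurable_funM; exact: measurable_neuron. Qed.

(** A neuron is cubic in |w|_1, [g_a] is a product of two neurons, and squaring it produces the
    twelfth moment. *)
Lemma g_a_second_moment (x y : 'cV[R]_d) : cube x -> cube y ->
  (\int[std_gauss d]_w (g_a A b c (vec (w : d.-tuple R)) x y ^+ 2)%:E
   <= ((5 / 3 * M) ^+ 4 * C_norm1 R d)%:E)%E.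
Proof.
move=> cx cy; rewrite EFinM -norm1_moment_fin -ge0_integralZl; last 4 first.
- exact: measurableT.
- by apply/measurable_EFinP; apply: measurable_funX; exact: measurable_norm1.
- by move=> w _; rewrite lee_fin exprn_ge0// norm1_ge0.
- by rewrite lee_fin exprn_ge0// mulr_ge0.
apply: ge0_le_integral => //.
- by move=> w _; rewrite lee_fin sqr_ge0.
- by apply/measurable_EFinP; apply: measurable_funX; exact: measurable_g_a.
- apply: measurable_funeM; apply/measurable_EFinP.
  by apply: measurable_funX; exact: measurable_norm1.
move=> w _; rewrite -EFinM lee_fin; set r := norm1 _.
have -> : (5 / 3 * M) ^+ 4 * r ^+ 12 = ((5 / 3 * M * r ^+ 3) * (5 / 3 * M * r ^+ 3)) ^+ 2.
  by ring.
rewrite -[leLHS]real_normK ?num_real// lerXn2r ?nnegrE//.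
  by rewrite -expr2 sqr_ge0.
by rewrite /g_a; apply: ler_normM; exact: neuron_le.
Qed.

End initialization.

(** * The kernel matrix and degenerate dimensions *)

Section least_eigenvalue.
Context {R : realType}.

(** The infimum of the empty set is 0 by convention, so a positive [lambda_min] excludes n = 0. *)
Lemma lambda_min0 (K : 'M[R]_0) : lambda_min K = 0.
Proof.
rewrite /lambda_min (_ : [set a | _] = set0) ?inf0//.
apply/seteqP; split => // a /= /eigenvalueP[v _]; apply/negP; rewrite negbK.
by apply/eqP/rowP => -[].
Qed.

Context {d n : nat}.
Variables (A : 'cV[R]_d -> 'M[R]_d) (b : 'cV[R]_d -> 'cV[R]_d)
  (c : 'cV[R]_d -> R) (X : 'I_n -> 'cV[R]_d).

Lemma K_aE i j :
  K_a A b c X i j = fine (\int[std_gauss d]_w (g_a A b c (vec w) (X i) (X j))%:E)%E.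
Proof. by rewrite mxE /k_a unlock. Qed.

Lemma K_a_sym : (K_a A b c X)^T = K_a A b c X.
Proof.
apply/matrixP => i j; rewrite mxE !K_aE; congr fine; apply: eq_integral => w _.
by rewrite /g_a mulrC.
Qed.

End least_eigenvalue.

(** For d = 0 every neuron vanishes, so K = 0 and the Rayleigh bound at the all-ones vector gives
    lambda n <= 0. *)
Lemma lambda_min_K_a_dims (R : realType) (d n : nat)
    (A : 'cV[R]_d -> 'M[R]_d) (b : 'cV[R]_d -> 'cV[R]_d) (c : 'cV[R]_d -> R)
    (X : 'I_n -> 'cV[R]_d) :
  0 < lambda_min (K_a A b c X) -> (0 < n)%N /\ (0 < d)%N.
Proof.
move=> lam0; have n0 : (0 < n)%N.
  by case: n X lam0 => // X; rewrite lambda_min0 ltxx.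
split => //; rewrite lt0n; apply/eqP => d0; subst d.
have K0 i j : K_a A b c X i j = 0.
  rewrite K_aE (_ : integral _ _ _ = 0)%E// -[RHS](integral0 (std_gauss 0) setT).
  apply: eq_integral => w _; rewrite /g_a neuronE /aform !dotE !big_ord0.
  by rewrite /sigma2 maxxx !mul0r expr0n/= mul0r mulr0 !addr0 mul0r.
have := @lambda_min_rayleigh R n (K_a A b c X) (const_mx 1) (K_a_sym A b c X).
rewrite [leRHS]big1 => [|i _]; last by rewrite big1 // => j _; rewrite K0 mulr0.
under eq_bigr do rewrite mxE expr1n.
by rewrite sumr_const card_ord pmulr_rle0// leNgt ltr0n n0.
Qed.

(** * Random initialization *)

Section alias.
Context {disp : measure_display} {T : measurableType disp} {R : realType}.

(* The normal law is a measure on the alias [measurableTypeR R] of R. *)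
Definition to_measurableTypeR (X : {mfun T >-> R}) : T -> measurableTypeR R := X.

Lemma measurable_to_measurableTypeR X : measurable_fun setT (to_measurableTypeR X).
Proof. exact: measurable_funPT X. Qed.

HB.instance Definition _ X := isMeasurableFun.Build _ _ _ _ (to_measurableTypeR X)
  (measurable_to_measurableTypeR X).

End alias.

Section random_initialization.
Context {disp : measure_display} {T : measurableType disp} {R : realType}
  (P : probability T R) {d m : nat}.
Variables (gamma : R) (a0 : 'I_m -> {RV P >-> R})
  (w0 : 'I_m -> {RV P >-> d.-tuple R}).
Hypotheses (hgamma : 0 < gamma < 1) (hinit : random_init gamma a0 w0).

Let theta0 (omega : T) : 'M[R]_(m, 1 + d) :=
  param (fun k => a0 k omega) (fun k => vec (w0 k omega)).

Lemma init_outer omega k : theta0 omega k (lshift d 0) = a0 k omega.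
Proof. by rewrite -outerE outer_param. Qed.

Lemma init_inner omega k j : theta0 omega k (rshift 1 j) = tnth (w0 k omega) j.
Proof. by rewrite -innerE inner_param mxE. Qed.

Lemma init_indep k l : k != l -> forall B B', measurable B -> measurable B' ->
  P (w0 k @^-1` B `&` w0 l @^-1` B') = (P (w0 k @^-1` B) * P (w0 l @^-1` B'))%E.
Proof.
move=> kl B B' mB mB'; have [_ _ indep] := hinit.
(* Mutual independence is used for the two indices [inr k] and [inr l]; the other values of [E] are
   fillers. *)
pose E (i : 'I_m + 'I_m) := match i with
  | inl _ => setT | inr i => if i == k then w0 k @^-1` B else w0 l @^-1` B' end.
have Ek : E (inr k) = w0 k @^-1` B by rewrite /E eqxx.
have El : E (inr l) = w0 l @^-1` B' by rewrite /E eq_sym (negbTE kl).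
have genE i : i \in [set inr k; inr l]%SET -> match i with
    | inl k => generated (a0 k) | inr k => generated (w0 k) end (E i).
  rewrite !inE => /orP[] /eqP ->; rewrite ?Ek ?El.
    by exists B => //; rewrite setTI.
  by exists B' => //; rewrite setTI.
have kl' : inr k \notin [set (inr l : 'I_m + 'I_m)]%SET.
  by rewrite inE; apply: contra kl => /eqP[->].
have := indep _ _ genE; rewrite big_setU1// big_set1 Ek El => <-.
congr (P _); apply/seteqP; split => omega.
  by move=> [kB lB] i /=; rewrite !inE => /orP[] /eqP ->; rewrite ?Ek ?El.
move=> H; split; [rewrite -[X in X omega]Ek|rewrite -[X in X omega]El];
by apply: H; rewrite /= !inE eqxx ?orbT.
Qed.

Lemma measurable_init k j : measurable_fun setT (fun omega => theta0 omega k j).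
Proof.
case: (split_ordP j) => j' ->.
  rewrite [j']ord1; under eq_fun do rewrite init_outer.
  exact: (measurable_funPT (a0 k)).
under eq_fun do rewrite init_inner.
exact: (measurableT_comp (measurable_tnth j') (measurable_funPT (w0 k))).
Qed.

(** Since gamma < 1, the outer weights obey the bound of a standard Gaussian, and one tail estimate
    serves all m (d + 1) parameters. *)
Lemma init_mgf k j t :
  (\int[P]_omega (expR (t * theta0 omega k j))%:E <= (expR (t ^+ 2 / 2))%:E)%E.
Proof.
have [lawa laww _] := hinit; have /andP[g0 g1] := hgamma.
case: (split_ordP j) => j' ->; last first.
  under eq_integral do rewrite init_inner.
  rewrite (ge0_integral_law _ _ _ _ _ (laww k)
    (fun w : d.-tuple R => (expR (t * tnth w j'))%:E)).
  - by rewrite std_gauss_coord_mgf.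
  - exact: measurable_expR_coord.
  - by move=> w; rewrite lee_fin expR_ge0.
rewrite [j']ord1; under eq_integral do rewrite init_outer.
have lawa' : has_law (P := P) (to_measurableTypeR (a0 k)) (normal_prob 0 gamma).
  by move=> B mB; exact: (lawa k B mB).
rewrite (ge0_integral_law _ _ _ _ _ lawa' (fun x : R => (expR (t * x))%:E)).
- rewrite normal_mgf ?gt_eqF// lee_fin ler_expR ler_wpM2r// ler_piMr ?sqr_ge0//.
  by rewrite expr_le1// ltW.
- by apply/measurable_EFinP; apply: measurableT_comp => //; exact: measurable_funM.
- by move=> x; rewrite lee_fin expR_ge0.
Qed.

End random_initialization.

Section good_initialization.
Context {R : realType} {d m n : nat}.
Variables (A : 'cV[R]_d -> 'M[R]_d) (b : 'cV[R]_d -> 'cV[R]_d)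
  (c : 'cV[R]_d -> R) (M : R) (X : 'I_n -> 'cV[R]_d).
Hypotheses (M0 : 0 <= M) (Abc : bounded_coefficients A b c M)
  (cX : forall i, cube (X i)) (m_gt0 : (0 < m)%N) (n_gt0 : (0 < n)%N).
Context {disp : measure_display} {T : measurableType disp} (P : probability T R).
Variables (gamma : R) (a0 : 'I_m -> {RV P >-> R})
  (w0 : 'I_m -> {RV P >-> d.-tuple R}).
Hypotheses (hgamma : 0 < gamma < 1) (hinit : random_init gamma a0 w0).

Let theta0 (omega : T) : 'M[R]_(m, 1 + d) :=
  param (fun k => a0 k omega) (fun k => vec (w0 k omega)).

Lemma gram_init_tail i j (eps : R) : 0 < eps ->
  measurable [set omega | (eps <= `|gram A b c X (theta0 omega) i j - K_a A b c X i j|)%R] /\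
  (P [set omega | (eps <= `|gram A b c X (theta0 omega) i j - K_a A b c X i j|)%R]
   <= ((5 / 3 * M) ^+ 4 * C_norm1 R d / (m%:R * eps ^+ 2))%:E)%E.
Proof.
move=> eps0; have [_ laww _] := hinit.
have gramE omega : gram A b c X (theta0 omega) i j =
    m%:R^-1 * \sum_k g_a A b c (vec (w0 k omega)) (X i) (X j).
  by congr (_ * _); apply: eq_bigr => k _; rewrite inner_param.
have mg := measurable_g_a A b c (X i) (X j).
have mgram : measurable_fun setT (fun omega =>
    gram A b c X (theta0 omega) i j - K_a A b c X i j).
  under eq_fun do rewrite gramE; apply: measurable_funB => //.
  apply: measurable_funM => //; apply: measurable_sum => k.
  exact: (measurableT_comp mg).
split; first exact: measurable_normr_ge.
have := mean_concentration _ P _ (std_gauss d) m w0 m_gt0 laww (init_indep P _ _ _ hinit)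
  (fun w => g_a A b c (vec w) (X i) (X j)) _ mg
  (g_a_second_moment _ _ _ _ M0 Abc _ _ (cX i) (cX j)) eps eps0.
apply: le_trans; rewrite le_eqVlt; apply/orP; left; apply/eqP; congr (P _).
by apply/seteqP; split => omega /=; rewrite gramE K_aE.
Qed.

Lemma good_init_event (rho eps : R) : 0 < rho -> 0 < eps ->
  exists E : set T, [/\ measurable E,
    ((1 - (m%:R * (d%:R + 1) * (2 * expR (- (rho ^+ 2 / 2))) +
      n%:R ^+ 2 * ((5 / 3 * M) ^+ 4 * C_norm1 R d / (m%:R * eps ^+ 2))))%:E <= P E)%E &
    forall omega, E omega ->
      (forall k j, `|theta0 omega k j| <= rho) /\
      (forall i j, `|gram A b c X (theta0 omega) i j - K_a A b c X i j| <= eps)].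
Proof.
move=> rho0 eps0.
pose B1 (p : 'I_m * 'I_(1 + d)) := [set omega | (rho <= `|theta0 omega p.1 p.2|)%R].
pose B2 (p : 'I_n * 'I_n) :=
  [set omega | (eps <= `|gram A b c X (theta0 omega) p.1 p.2 - K_a A b c X p.1 p.2|)%R].
have [mU1 PU1] := union_bound _ _ _ P _ B1 _
  (fun p => measurable_normr_ge _ _ _ _ rho (measurable_init P a0 w0 p.1 p.2))
  (fun p => subgaussian_tail _ P _ rho (measurable_init P a0 w0 p.1 p.2) rho0
    (init_mgf P _ _ _ hgamma hinit p.1 p.2)).
have [mU2 PU2] := union_bound _ _ _ P _ B2 _
  (fun p => proj1 (gram_init_tail p.1 p.2 eps eps0))
  (fun p => proj2 (gram_init_tail p.1 p.2 eps eps0)).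
set U1 := \big[setU/set0]_p B1 p in mU1 PU1.
set U2 := \big[setU/set0]_p B2 p in mU2 PU2.
exists (~` (U1 `|` U2)); split.
- by apply: measurableC; exact: measurableU.
- rewrite probability_setC; last exact: measurableU.
  rewrite EFinB leeB//; apply: le_trans (measureU2 _ _ _) _ => //.
  rewrite EFinD leeD//.
    apply: le_trans PU1 _; rewrite card_prod !card_ord lee_fin.
    by rewrite natrM natrD addrC.
  by apply: le_trans PU2 _; rewrite card_prod !card_ord natrM expr2.
move=> omega /= /not_orP[U1o U2o]; split.
  move=> k j; rewrite leNgt; apply/negP => kj; apply: U1o.
  by rewrite /U1 (bigD1 (k, j))//=; left; exact: ltW.
move=> i j; rewrite leNgt; apply/negP => ij; apply: U2o.
by rewrite /U2 (bigD1 (i, j))//=; left; exact: ltW.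
Qed.

End good_initialization.

(* No parameter may move by more than r: a drift of rho keeps the parameters
   below 2 rho, and a drift of 3 lam / (6400 n M^2 d^6 rho^5) moves the entries of
   the Gram matrix by at most lam / (4 n). *)
Lemma width_bounds_drift (R : realType) (m n d : nat) (M lam L S : R) :
  (0 < m)%N -> (0 < n)%N -> (0 < d)%N -> 1 <= M -> 0 < lam -> 0 < L -> 0 <= S ->
  200 * Num.sqrt 2 * M * d%:R ^+ 3 * n%:R * L * S / lam <= m%:R ->
  2 ^+ 23 * M ^+ 3 * d%:R ^+ 9 * n%:R ^+ 2 * L ^+ 4 * S / lam ^+ 2 <= m%:R ->
  let rho := Num.sqrt (2 * L) in
  exists r, [/\ r <= rho,
    80 * Num.sqrt 2 * n%:R * M * d%:R ^+ 3 * rho ^+ 3 * S / (m%:R * lam) < r &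
    1600 / 3 * M ^+ 2 * d%:R ^+ 6 * rho ^+ 5 * r <= lam / (4 * n%:R)].
Proof.
move=> m0 n0 d0 M1 lam0 L0 S0 H2 H3 rho.
have mR : 0 < m%:R :> R by rewrite ltr0n.
have nR : 0 < n%:R :> R by rewrite ltr0n.
have dR : 0 < d%:R :> R by rewrite ltr0n.
have M0 : 0 < M by exact: lt_le_trans M1.
have rho0 : 0 < rho by rewrite sqrtr_gt0 mulr_gt0.
have rho2 : rho ^+ 2 = 2 * L by rewrite sqr_sqrtr// mulr_ge0// ltW.
have s2 : Num.sqrt 2 <= 3 / 2 :> R.
  by rewrite -[leRHS]ger0_norm// -sqrtr_sqr ler_wsqrtr//; clear; lra.
have s20 : 0 <= Num.sqrt 2 :> R by exact: sqrtr_ge0.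
pose r2 := 3 * lam / (6400 * n%:R * M ^+ 2 * d%:R ^+ 6 * rho ^+ 5).
have r20 : 0 < r2.
  have -> : r2 = 3 / 6400 * (lam / (n%:R * M ^+ 2 * d%:R ^+ 6 * rho ^+ 5)).
    by rewrite /r2; field; rewrite !gt_eqF.
  apply: mulr_gt0; first by clear; lra.
  by rewrite divr_gt0// !mulr_gt0// exprn_gt0.
set D := _ / (m%:R * lam).
(* As rho^2 = 2 L, D / rho is 4/5 of the second width bound divided by m. *)
have Drho : D <= 4 / 5 * rho.
  have -> : D = 2 / 5 *
      (200 * Num.sqrt 2 * M * d%:R ^+ 3 * n%:R * (rho ^+ 2) * S / lam) / m%:R * rho.
    by rewrite /D; field; rewrite !gt_eqF.
  rewrite rho2 ler_wpM2r ?(ltW rho0)// ler_pdivrMr//.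
  have -> : 200 * Num.sqrt 2 * M * d%:R ^+ 3 * n%:R * (2 * L) * S / lam =
    2 * (200 * Num.sqrt 2 * M * d%:R ^+ 3 * n%:R * L * S / lam).
    by field; rewrite gt_eqF.
  by clear -H2; lra.
(* With rho^8 = 16 L^4, D / r2 is (125/3) sqrt 2 y / m, where 128 y is the third width bound. Since
   sqrt 2 <= 3/2, it is at most 62.5 / 128. *)
have Dr2 : D <= 3 / 4 * r2.
  have rho8 : rho ^+ 8 = 16 * L ^+ 4.
    by rewrite (exprM rho 2 4) rho2; ring.
  have -> : D = (80 * 6400 / 3 * Num.sqrt 2 *
      (M ^+ 3 * d%:R ^+ 9 * n%:R ^+ 2 * rho ^+ 8 * S / lam ^+ 2)) / m%:R * r2.
    by rewrite /D /r2; field; rewrite !gt_eqF.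
  rewrite ler_wpM2r ?(ltW r20)// ler_pdivrMr// rho8.
  set Z := M ^+ 3 * d%:R ^+ 9 * n%:R ^+ 2 * L ^+ 4 * S / lam ^+ 2.
  have Z0 : 0 <= Z.
    have [M0' L0' lam0'] := And3 (ltW M0) (ltW L0) (ltW lam0).
    by rewrite /Z divr_ge0 ?mulr_ge0 ?exprn_ge0.
  have HZ : 128 * (2 ^+ 16 * Z) <= m%:R.
    by apply: le_trans H3; rewrite le_eqVlt /Z; apply/orP; left; apply/eqP; ring.
  have -> : M ^+ 3 * d%:R ^+ 9 * n%:R ^+ 2 * (16 * L ^+ 4) * S / lam ^+ 2 = 16 * Z.
    by rewrite /Z; ring.
  have -> : 80 * 6400 / 3 * Num.sqrt 2 * (16 * Z)
      = 125 / 3 * (Num.sqrt 2 * (2 ^+ 16 * Z)) by field.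
  have {Z0} : 0 <= 2 ^+ 16 * Z by rewrite mulr_ge0// exprn_ge0.
  move: (2 ^+ 16 * Z) HZ => y HZ y0.
  have sy : Num.sqrt 2 * y <= 3 / 2 * y by rewrite ler_wpM2r.
  by clear -HZ sy y0; lra.
(* The factors 4/5 and 3/4 make the drift strictly smaller than both candidates. *)
exists (Num.min rho r2); split.
- by rewrite ge_min lexx.
- have rho_lt : 4 / 5 * rho < rho by clear -rho0; lra.
  have r2_lt : 3 / 4 * r2 < r2 by clear -r20; move: (r2) r20 => y y0; lra.
  by rewrite lt_min (le_lt_trans Drho rho_lt) (le_lt_trans Dr2 r2_lt).
have C0 : 0 <= 1600 / 3 * M ^+ 2 * d%:R ^+ 6 * rho ^+ 5.
  rewrite -!mulrA mulrA; apply: mulr_ge0; first by clear; lra.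
  by rewrite !mulr_ge0// ?exprn_ge0// ltW.
apply: (@le_trans _ _ (1600 / 3 * M ^+ 2 * d%:R ^+ 6 * rho ^+ 5 * r2)).
  by rewrite ler_wpM2l// ge_min lexx orbT.
by rewrite le_eqVlt; apply/orP; left; apply/eqP; rewrite /r2; field; rewrite !gt_eqF.
Qed.

Theorem theorem3p1 (R : realType) (d m n : nat)
  (A : 'cV[R]_d -> 'M[R]_d) (b : 'cV[R]_d -> 'cV[R]_d) (c f : 'cV[R]_d -> R)
  (M : R) (hM : 1 <= M) (hL : bounded_coefficients A b c M)
  (hf : forall x, cube x -> `|f x| <= 1)
  (X : 'I_n -> 'cV[R]_d) (hX : forall i, cube (X i))
  (hlambda : 0 < lambda_min (K_a A b c X))
  (disp : measure_display) (T : measurableType disp) (P : probability T R)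
  (gamma : R) (hgamma : 0 < gamma < 1)
  (a0 : 'I_m -> {RV P >-> R}) (w0 : 'I_m -> {RV P >-> d.-tuple R})
  (hinit : random_init gamma a0 w0)
  (delta : R) (hdelta : 0 < delta < 1) :
  let lambda := lambda_min (K_a A b c X) in
  let RS := emp_risk A b c f X in
  let theta0 := fun omega : T =>
    param (fun k => a0 k omega) (fun k => vec (w0 k omega)) in
  let L := ln (4 * m%:R * (d%:R + 1) / delta) in
  exists E : set T, [/\ measurable E, ((1 - delta)%:E <= P E)%E
    & forall omega, E omega ->
      Num.max (Num.max
        (512 * n%:R ^+ 4 * M ^+ 4 * C_norm1 R d / (lambda ^+ 2 * delta))
        (200 * Num.sqrt 2 * M * d%:R ^+ 3 * n%:R * L
          * Num.sqrt (RS (theta0 omega)) / lambda))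
        (2 ^+ 23 * M ^+ 3 * d%:R ^+ 9 * n%:R ^+ 2 * L ^+ 4
          * Num.sqrt (RS (theta0 omega)) / lambda ^+ 2)
      <= m%:R ->
      forall theta : R -> 'M[R]_(m, 1 + d),
        gradient_flow RS (theta0 omega) theta ->
        forall t : R, 0 <= t ->
          RS (theta t)
          <= expR (- (m%:R * lambda * t / n%:R)) * RS (theta0 omega)].
Proof.
move=> lambda RS theta0 L.
have M0 : 0 <= M by exact: le_trans hM.
have [n_gt0 d_gt0] := lambda_min_K_a_dims _ _ _ A b c X hlambda.
(* Without neurons the parameter space is a single point and the exponent is 0. *)
have [m0|m_gt0] := posnP m.
  exists setT; split => //; first by rewrite probability_setT lee_fin; lra.
  move=> omega _ _ theta _ t _.
  have -> : theta t = theta0 omega by apply/matrixP => k; have := ltn_ord k; rewrite {2}m0.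
  by rewrite m0 !mul0r oppr0 expR0 mul1r.
set bnd := 512 * n%:R ^+ 4 * M ^+ 4 * C_norm1 R d / (lambda ^+ 2 * delta).
(* The first width bound is deterministic: if it fails, the implication is vacuous for every
   outcome. *)
have [m_ge|m_lt] := leP bnd m%:R; last first.
  exists setT; split => //; first by rewrite probability_setT lee_fin; lra.
  by move=> omega _; rewrite !ge_max leNgt m_lt.
have mR : 0 < m%:R :> R by rewrite ltr0n.
have nR : 0 < n%:R :> R by rewrite ltr0n.
have dR : 0 < d%:R :> R by rewrite ltr0n.
have /andP[delta0 delta1] := hdelta.
have m1 : 1 <= m%:R :> R by rewrite ler1n.
have arg_gt1 : 1 < 4 * m%:R * (d%:R + 1) / delta.
  by rewrite ltr_pdivlMr// mul1r; nra.
have L0 : 0 < L by exact: ln_gt0.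
(* Chosen so that exp(- rho^2 / 2) = delta / (4 m (d + 1)): the m (d + 1) two-sided tails together
   cost delta / 2. *)
pose rho := Num.sqrt (2 * L).
have rho0 : 0 < rho by rewrite sqrtr_gt0 mulr_gt0.
have rho2 : rho ^+ 2 / 2 = L by rewrite sqr_sqrtr ?mulr_ge0 ?ltW//; field.
have eps0 : 0 < lambda / (4 * n%:R) by rewrite divr_gt0// mulr_gt0.
have [E [mE PE goodE]] := good_init_event A b c M X M0 hL hX m_gt0 P gamma a0 w0
  hgamma hinit rho _ rho0 eps0.
exists E; split => //.
  apply: le_trans PE; rewrite lee_fin lerD2l lerN2 rho2.
  have -> : expR (- L) = delta / (4 * m%:R * (d%:R + 1)).
    by rewrite expRN lnK ?posrE ?(lt_trans ltr01)// invf_div.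
  (* The Gram tails: (5/3)^4 4^2 = 10000/81, and its quotient by 512 is below 1/4, so both failures
     together cost less than delta. *)
  have -> : n%:R ^+ 2 * ((5 / 3 * M) ^+ 4 * C_norm1 R d / (m%:R * (lambda / (4 * n%:R)) ^+ 2))
      = (10000 / 81 / 512) * delta * (bnd / m%:R).
    by rewrite /bnd; field; rewrite !gt_eqF//.
  have -> : m%:R * (d%:R + 1) * (2 * (delta / (4 * m%:R * (d%:R + 1)))) = delta / 2.
    by field; rewrite !gt_eqF// ltr_wpDr.
  have : bnd / m%:R <= 1 by rewrite ler_pdivrMr// mul1r.
  by move=> /(ler_wpM2l (ltW delta0)); lra.
move=> omega /goodE[theta0_le gramK]; rewrite !ge_max => /andP[/andP[_ H2] H3].
have [r [rrho Dr rsmall]] := width_bounds_drift _ _ _ _ _ _ _ _ m_gt0 n_gt0 d_gt0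
  hM hlambda L0 (sqrtr_ge0 _) H2 H3.
move=> theta [v [intv thetaE clarke]] t t0.
exact: (flow_decay A b c f M X M0 hL hX m_gt0 n_gt0 (K_a A b c X) lambda rho r
  (theta0 omega) hlambda rho0 rrho
  (fun u => lambda_min_rayleigh _ u (K_a_sym A b c X))
  gramK theta0_le rsmall theta v intv thetaE clarke Dr).
Qed.
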